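(* Let $g$ be a positive integer with $g\equiv 2$ or $4\pmod 6$, and suppose that there exists a 4-GDD of type $g^6d^1$ for every positive integer $d<g$ with $d\equiv g\pmod 3$. Then there exists a 4-GDD of type $g^{21}m_1^1$ for every positive integer $m_1\equiv g\pmod 3$ with $m_1\le 10g$, and a 4-GDD of type $g^{27}m_2^1$ for every positive integer $m_2\equiv g\pmod 3$ with $m_2\le 13g$.
   Context: For a set $K$ of positive integers, a $K$-GDD (group divisible design) is a triple $(V,\mathcal G,\mathcal B)$ where $V$ is a finite set, $\mathcal G$ is a partition of $V$ into subsets called groups, $\mathcal B$ is a nonempty collection of subsets of $V$ (blocks) with sizes in $K$, such that every pair of points from distinct groups lies in exactly one block and no pair of points from the same group lies in any block. A $k$-GDD means a $\{k\}$-GDD. The type $g_1^{u_1}\cdots g_r^{u_r}$ means exactly $u_i$ groups of size $g_i$ for each $i$; type $g^u m^1$ means $u$ groups of size $g$ and one group of size $m$ (if $m=g$ this is type $g^{u+1}$). *)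

(* Defs.v *)
From mathcomp Require Import all_boot all_order.
Set Implicit Arguments. Unset Strict Implicit. Unset Printing Implicit Defensive.

Definition is_GDD (K : pred nat) (V : finType) (G : {set {set V}})
    (B : seq {set V}) : Prop :=
  [/\ partition G [set: V],
      0 < size B,
      all (fun b : {set V} => K #|b|) B,
      (forall x y : V, x != y -> pblock G x != pblock G y ->
          count (fun b : {set V} => (x \in b) && (y \in b)) B = 1) &
      (forall x y : V, x != y -> pblock G x = pblock G y ->
          count (fun b : {set V} => (x \in b) && (y \in b)) B = 0)].

Definition is_kGDD (k : nat) := is_GDD (pred1 k).

Definition has_type (V : finType) (G : {set {set V}}) (t : seq nat) : Prop :=
  perm_eq [seq #|A| | A : {set V} <- enum G] t.

Definition exists_kGDD (k : nat) (t : seq nat) : Prop :=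
  exists (V : finType) (G : {set {set V}}) (B : seq {set V}),
    is_kGDD k G B /\ has_type G t.

Definition type_gum (g u m : nat) : seq nat := rcons (nseq u g) m.

(* Main.v *)
Require Import Defs.
From mathcomp Require Import all_boot all_order all_algebra all_field.
From mathcomp Require Import ring zify.
Set Implicit Arguments. Unset Strict Implicit. Unset Printing Implicit Defensive.
Import GRing.Theory.

(** Write [gdd g u m] for the existence of a 4-GDD of type g^u m^1 (with m = 0
allowed), that is, of a decomposition of the complete multipartite graph into
copies of K_4, and let h = g/2.

For u = 5, 7, 9 there are 4-GDDs of type (6h)^u m^1 for every multiple m of 3 with
m <= 3h(u-1).  The cases h = 1, 2 are explicit designs with a cyclic automorphism
group.  To pass from h to hq: if q >= u is prime, inflate with a transversal design
TD(u+1, q) coming from the lines of the plane over the field F_q; the q points of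
its last group may carry different weights, so that m is an arbitrary sum of q
admissible values.  If 4 <= q < u is a prime power, inflate the blocks of a design
of type (6h)^u m0^1 by the non-constant lines only, and put a design of type
(6h)^u m1^1 on every layer, all layers sharing the m1 points; this gives
m = m0(q-1) + m1, which again takes all admissible values.

As 3g = 6h, a TD(4, g) on each group of size 3g and g further points turns a
4-GDD of type (3g)^u m^1 into one of type g^(3u) (m+g)^1; this proves the theorem
for m1, m2 >= g.  If d < g, the group of size 6g + d in a 4-GDD of type
g^15 (6g+d)^1 or g^21 (6g+d)^1 can be replaced by the given 4-GDD of type g^6 d^1.
A TD(4, g) does not exist for g = 2, where all designs are explicit. *)

(** * Decompositions into copies of K_4 *)

(** Both bounds are extremal. Through a point of a group of size g, the m points of the last group
    lie in m different blocks, each with two further points, so 2m <= g(u-1): this is 10g for u = 21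
    and 13g for u = 27. Counting the neighbours of a point forces m = g modulo 3. Every admissible m
    has to be reached, so each construction must preserve the extreme case: inflation by q
    multiplies the bound by q, and filling the groups of size 3g turns m <= 3g(u-1)/2 into m + g <=
    g(3u-1)/2. That filling always adds g points to the last group, so it never yields m < g; this
    is where the hypothesis on g^6 d^1 enters. The values u = 5, 7, 9 arise because 21 = 3*7 and 27
    = 3*9, while 15 = 3*5 and 21 remain when six groups are set aside. As g is prime to 3, so is h:
    its prime factors are 2 or at least 5, and the field of order 3, with only three slopes where
    four are needed, never occurs. *)

(** Blocks are injections of ['I_4] rather than sets, so that they can be pushed
along injections and inflated coordinatewise. *)
Definition k4dec (V : finType) (E : rel V) : Prop :=
  exists (J : finType) (e : J -> 'I_4 -> V),
  [/\ forall j, injective (e j),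
      forall j k k', k != k' -> E (e j k) (e j k'),
      forall x y, x != y -> E x y -> exists j k k', e j k = x /\ e j k' = y &
      forall j j' k k' l l', k != k' ->
        e j k = e j' l -> e j k' = e j' l' -> j = j'].

(** The common frame of most constructions below: [E] is cut into the images of the relations [D i],
    each decomposed on its own. The last hypothesis says that an edge lies in a single piece; inside
    a piece, injectivity of [f i] carries uniqueness over. *)
Lemma k4dec_glue (V I : finType) (W : I -> finType) (f : forall i, W i -> V)
    (D : forall i, rel (W i)) (E : rel V) :
  (forall i, injective (@f i)) ->
  (forall i, k4dec (@D i)) ->
  (forall i w w', w != w' -> D i w w' -> E (f i w) (f i w')) ->
  (forall x y, x != y -> E x y ->
     exists i w w', [/\ f i w = x, f i w' = y & D i w w']) ->
  (forall i i' w w' t t', w != w' -> t != t' -> D i w w' -> D i' t t' ->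
     f i w = f i' t -> f i w' = f i' t' -> i = i') ->
  k4dec E.
Proof.
move=> finj decD sound compl uni.
have [J HJ] := fin_all_exists decD.
have [e He] := fin_all_exists HJ.
exists {i : I & J i}, (fun j k => f (tag j) (e (tag j) (tagged j) k)).
have einj i : forall j, injective (e i j) by case: (He i).
have esound i j k k' : k != k' -> D i (e i j k) (e i j k').
  by case: (He i) => _ H _ _; apply: H.
split.
- by move=> j k k' /finj /einj.
- move=> j k k' nk; apply: sound; last exact: esound.
  by rewrite (inj_eq (@einj _ _)).
- move=> x y nxy Exy; have [i [w [w' [fw fw' Dw]]]] := compl _ _ nxy Exy.
  have nw : w != w' by apply: contraNneq nxy => ww; rewrite -fw -fw' ww.
  have [_ _ H _] := He i; have [j [k [k' [ek ek']]]] := H _ _ nw Dw.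
  by exists (Tagged J j), k, k' => /=; rewrite ek ek'.
- move=> [i j] [i' j'] k k' l l' nk /= E1 E2.
  have nl : l != l'.
    apply: contraNneq nk => ll; apply/eqP/(@einj i j)/(@finj i).
    by rewrite E1 E2 ll.
  have ii : i = i'.
    by apply: (uni _ _ _ _ _ _ _ _ (esound _ j _ _ nk) (esound _ j' _ _ nl)) => //;
      rewrite (inj_eq (@einj _ _)).
  move: j' E1 E2; rewrite -ii => j' /finj E1 /finj E2.
  by have [_ _ _ H] := He i; rewrite (H _ _ _ _ _ _ nk E1 E2).
Qed.

Lemma k4dec_bij (V V' : finType) (E : rel V) (E' : rel V') (f : V -> V') :
  injective f -> #|V'| <= #|V| ->
  (forall x y, E' (f x) (f y) = E x y) -> k4dec E -> k4dec E'.
Proof.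
move=> finj le_card fE decE.
apply: (@k4dec_glue V' unit (fun=> V) (fun=> f) (fun=> E)) => //.
- by move=> _ w w' _; rewrite fE.
- move=> x y _; have onto z : exists w, f w = z.
    by have /codomP [w ->] := inj_card_onto finj le_card z; exists w.
  have [[w <-] [w' <-]] := (onto x, onto y).
  by rewrite fE => Dw; exists tt, w, w'.
- by move=> i i' *; case: (i) (i') => -[].
Qed.

Lemma k4dec_clique : @k4dec 'I_4 (fun x y => x != y).
Proof.
exists unit, (fun _ k => k); split.
- by move=> _ x y.
- by [].
- by move=> x y _ _; exists tt, x, y.
- by move=> [] [].
Qed.

Definition multipartite (V : finType) (L : eqType) (c : V -> L) : rel V :=
  fun x y => c x != c y.

(** Reserving [None] for the exceptional group spares the cases m = 0 and m = g a separate
    treatment. *)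
Definition gdd_label (X L M : finType) (p : X * L + M) : option L :=
  if p is inl x then Some x.2 else None.

Definition gdd (g u m : nat) : Prop :=
  k4dec (multipartite (@gdd_label 'I_g 'I_u 'I_m)).

(** Send [x] to the point of the same rank in the class of [c'] with the same label. Equal class
    sizes make the ranks match, and summing them over the labels gives the cardinality needed for a
    bijection. *)
Lemma k4dec_multipartite (V V' L : finType) (c : V -> L) (c' : V' -> L) :
  (forall l, #|[pred x | c x == l]| = #|[pred x | c' x == l]|) ->
  k4dec (multipartite c) -> k4dec (multipartite c').
Proof.
move=> Hcard.
have step x : exists y, c' y = c x /\
    index y (enum [pred z | c' z == c x]) = index x (enum [pred z | c z == c x]).
  have xin : x \in enum [pred z | c z == c x] by rewrite mem_enum inE.
  have : index x (enum [pred z | c z == c x]) < size (enum [pred z | c' z == c x]).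
    by rewrite -cardE -Hcard cardE index_mem.
  set i := index _ _ => lt_i.
  have [y0 _] : exists y0 : V', y0 \in enum [pred z | c' z == c x].
    by case: (enum _) lt_i => // y s _; exists y; rewrite mem_head.
  have := mem_nth y0 lt_i; rewrite mem_enum inE => /eqP cy.
  by exists (nth y0 (enum [pred z | c' z == c x]) i); rewrite index_uniq ?enum_uniq.
have [f Hf] := fin_all_exists step.
apply: (@k4dec_bij _ _ _ _ f).
- move=> x y fxy; have [cx ix] := Hf x; have [cy iy] := Hf y.
  have cxy : c x = c y by rewrite -cx -cy fxy.
  rewrite -cxy in iy; apply: (@index_inj _ x (enum [pred z | c z == c x])).
  + by rewrite mem_enum inE.
  + by rewrite mem_enum inE cxy.
  + by rewrite -ix -iy fxy.
- rewrite -!sum1_card (partition_big c' predT) //= [X in _ <= X](partition_big c predT) //=.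
  by apply: eq_leq; apply: eq_bigr => l _; rewrite !sum1_card -Hcard.
- by move=> x y; rewrite /multipartite; have [-> _] := Hf x; have [-> _] := Hf y.
Qed.

Lemma k4dec_relabel (V : finType) (L L' : eqType) (c : V -> L) (r : L -> L') :
  injective r -> k4dec (multipartite c) -> k4dec (multipartite (r \o c)).
Proof.
move=> rinj; apply: (@k4dec_bij _ _ _ _ id) => // x y.
by rewrite /multipartite /= (inj_eq rinj).
Qed.

Lemma card_label_some (X L M : finType) (l : L) :
  #|[pred p | @gdd_label X L M p == Some l]| = #|X|.
Proof.
rewrite -(card_image (f := fun x : X => inl (x, l) : X * L + M)); last by move=> x y [].
apply: eq_card => -[[x l']|z]; rewrite !inE /gdd_label /=.
- apply/eqP/imageP => [[<-]|[y _ [_ ->]] //]; by exists x.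
- by apply/esym/imageP => -[].
Qed.

Lemma card_label_none (X L M : finType) :
  #|[pred p | @gdd_label X L M p == None]| = #|M|.
Proof.
rewrite -(card_image (f := fun z : M => inr z : X * L + M)); last by move=> x y [].
apply: eq_card => -[[x l']|z]; rewrite !inE /gdd_label /=.
- by apply/esym/imageP => -[].
- by apply/esym/imageP; exists z.
Qed.

(** Only class sizes matter, so every construction may use its own point set and its own index type
    [L] for the groups. *)
Lemma gddP (V L : finType) (c : V -> option L) (g u m : nat) :
  #|L| = u -> (forall l, #|[pred x | c x == Some l]| = g) ->
  #|[pred x | c x == None]| = m ->
  gdd g u m <-> k4dec (multipartite c).
Proof.
move=> cardL cardg cardm.
pose r (l : option 'I_u) := omap (fun i => enum_val (cast_ord (esym cardL) i)) l.
pose r' (l : option L) := omap (fun i => cast_ord cardL (enum_rank i)) l.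
have rK : cancel r r' by case=> //= i; rewrite enum_valK cast_ordKV.
have r'K : cancel r' r by case=> //= i; rewrite cast_ordK enum_rankK.
have Hc l : #|[pred x | (r' \o c) x == l]| = #|[pred x | @gdd_label 'I_g 'I_u 'I_m x == l]|.
  transitivity #|[pred x | c x == r l]|.
    by apply: eq_card => x; rewrite !inE /= (can2_eq r'K rK).
  case: l => [i|] /=; first by rewrite cardg card_label_some card_ord.
  by rewrite cardm card_label_none card_ord.
split=> H.
- have := k4dec_relabel (can_inj rK) (k4dec_multipartite (fun l => esym (Hc l)) H).
  apply: k4dec_bij (@inj_id _) (leqnn _) _ => x y.
  by rewrite /multipartite /= !r'K.
- exact: k4dec_multipartite Hc (k4dec_relabel (can_inj r'K) H).
Qed.

Lemma gdd_sumP (X L M : finType) :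
  gdd #|X| #|L| #|M| <-> k4dec (multipartite (@gdd_label X L M)).
Proof.
by apply: gddP => // [l|]; rewrite ?card_label_some ?card_label_none.
Qed.

(** * Group divisible designs as set systems *)

Lemma count_enum1 (J : finType) (P : pred J) j :
  (forall i, P i = (i == j)) -> count P (enum J) = 1.
Proof.
by move=> HP; rewrite -sum1_count big_enum_cond /= (big_pred1 j).
Qed.

(** Positivity makes every class inhabited, as the parts of a partition must be, so that different
    labels give different sets; it also provides an edge, hence a block. *)
Lemma exists_kGDD_of_gdd (g u m : nat) : 0 < g -> 0 < u -> 0 < m ->
  gdd g u m -> exists_kGDD 4 (type_gum g u m).
Proof.
move=> g0 u0 m0 [J [e [e_inj sound compl uniq_e]]].
pose V : finType := ('I_g * 'I_u + 'I_m)%type.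
pose c : V -> option 'I_u := @gdd_label 'I_g 'I_u 'I_m.
pose cls (l : option 'I_u) := [set p | c p == l].
have cls_inj : injective cls.
  have pt l : exists p, p \in cls l.
    case: l => [i|]; last by exists (inr (Ordinal m0)); rewrite inE.
    by exists (inl (Ordinal g0, i)); rewrite inE.
  move=> l l' E; have [p pl] := pt l; move: (pl); rewrite E.
  by move: pl; rewrite !inE => /eqP <- /eqP <-.
pose G := [set cls l | l in [set: option 'I_u]].
have partG : partition G [set: V].
  have -> : G = preim_partition c [set: V]; last exact: preim_partitionP.
  apply/setP=> A; apply/imsetP/imsetP => [[l _ ->]|[p _ ->]].
  - have : exists p, p \in cls l.
      case: l => [i|]; last by exists (inr (Ordinal m0)); rewrite inE.
      by exists (inl (Ordinal g0, i)); rewrite inE.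
    move=> [p]; rewrite inE => /eqP cp; exists p => //.
    by apply/setP=> q; rewrite !inE cp.
  - by exists (c p) => //; apply/setP=> q; rewrite !inE.
have [_ trivG _] := and3P partG; have covG : cover G = setT := cover_partition partG.
have pblockE p : pblock G p = cls (c p).
  apply: def_pblock => //; last by rewrite inE.
  by apply/imsetP; exists (c p).
pose B := [seq [set e j k | k : 'I_4] | j <- enum J].
have count_B x y : count (fun b : {set V} => (x \in b) && (y \in b)) B =
    count (fun j => [exists k, e j k == x] && [exists k, e j k == y]) (enum J).
  rewrite count_map; apply: eq_count => j /=; congr (_ && _);
    by apply/imsetP/existsP => [[k _ ->]|[k /eqP <-]]; exists k.
exists V, G, B; split; first split=> //.
- have [j _] := compl (inl (Ordinal g0, Ordinal u0)) (inr (Ordinal m0)) isT isT.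
  by rewrite size_map -cardE; apply/card_gt0P; exists j.
- rewrite all_map; apply/allP => j _ /=.
  by rewrite card_imset ?card_ord //; apply: e_inj.
- move=> x y nxy; rewrite !pblockE (inj_eq cls_inj) => Exy.
  have [j [k [k' [Ek Ek']]]] := compl x y nxy Exy.
  rewrite count_B; apply: (@count_enum1 _ _ j) => i.
  apply/andP/eqP => [[/existsP[l /eqP El] /existsP[l' /eqP El']]|->].
  + have nl : l != l' by apply: contraNneq nxy => ll; rewrite -El -El' ll.
    by apply: (uniq_e _ _ _ _ _ _ nl); [rewrite El; apply: esym Ek | rewrite El'; apply: esym Ek'].
  + by split; apply/existsP; [exists k | exists k']; apply/eqP.
- move=> x y nxy; rewrite !pblockE => /cls_inj cxy.
  rewrite count_B; apply/eqP; rewrite -leqn0 leqNgt -has_count; apply/hasPn => j _.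
  apply/negP => /andP[/existsP[l /eqP El] /existsP[l' /eqP El']].
  have nl : l != l' by apply: contraNneq nxy => ll; rewrite -El -El' ll.
  by have := sound j _ _ nl; rewrite El El' /multipartite -/c cxy eqxx.
- rewrite /has_type /type_gum perm_sym perm_rcons perm_sym.
  have /(perm_map (fun A : {set V} => #|A|)) :
      perm_eq (enum G) [seq cls l | l <- None :: map Some (enum 'I_u)].
    apply: uniq_perm; rewrite ?enum_uniq // ?(map_inj_uniq cls_inj).
      rewrite /= map_inj_uniq ?enum_uniq ?andbT; last by move=> ? ? [].
      by apply/mapP => -[].
    move=> A; rewrite mem_enum; apply/imsetP/mapP => [[l _ ->]|[l _ ->]]; exists l => //.
    by case: l => [i|]; rewrite inE // map_f ?orbT // mem_enum.
  move=> /perm_trans; apply; rewrite /=.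
  have card_cls l : #|cls l| = #|[pred p | c p == l]| by apply: eq_card => p; rewrite !inE.
  rewrite card_cls card_label_none card_ord perm_cons.
  have -> // : [seq #|A| | A : {set V} <- [seq cls l | l <- [seq Some i | i <- enum 'I_u]]]
      = nseq u g.
  rewrite -[u in nseq u]size_enum_ord.
  elim: (enum 'I_u) => //= i s ->; congr (_ :: _).
  by rewrite card_cls card_label_some card_ord.
Qed.

Lemma gdd_of_exists_kGDD (g u m : nat) :
  exists_kGDD 4 (type_gum g u m) -> gdd g u m.
Proof.
move=> [V [G [B [[partG _ /allP sizeB cross same] typeG]]]].
(* Order the groups so that their sizes read as [type_gum g u m]; the exceptional group then stands
   last. *)
have [s perm_s card_s] :
    exists2 s, perm_eq s (enum G) & map (fun A : {set V} => #|A|) s = type_gum g u m.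
  move: typeG; rewrite /has_type perm_sym => /(perm_iotaP 0) [Is perm_Is ->].
  exists (map (nth set0 (enum G)) Is).
    rewrite -[X in perm_eq _ X](mkseq_nth set0); apply: perm_map.
    by rewrite (perm_trans perm_Is) // size_map.
  rewrite -map_comp; apply/eq_in_map => i.
  rewrite (perm_mem perm_Is) mem_iota size_map => /andP[_ lt_i] /=.
  by rewrite (nth_map set0).
have size_s : size s = u.+1.
  by rewrite -(size_map (fun A : {set V} => #|A|)) card_s size_rcons size_nseq.
have uniq_s : uniq s by rewrite (perm_uniq perm_s) enum_uniq.
have mem_s x : pblock G x \in s.
  by rewrite (perm_mem perm_s) mem_enum pblock_mem // (cover_partition partG) inE.
have card_nth i : i <= u -> #|nth set0 s i| = nth 0 (type_gum g u m) i.
  by move=> le_i; rewrite -card_s (nth_map set0) // size_s.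
have trivG : trivIset G by case/and3P: partG.
have pblock_nth x i : i <= u -> (pblock G x == nth set0 s i) = (x \in nth set0 s i).
  move=> le_i; have Gi : nth set0 s i \in G.
    by rewrite -mem_enum -(perm_mem perm_s) mem_nth ?size_s.
  apply/eqP/idP => [<-|xi]; last exact: def_pblock.
  by rewrite mem_pblock (cover_partition partG) inE.
(* The last group has index [u], out of range for ['I_u], so [insub] sends exactly this group to
   [None]. *)
pose c x : option 'I_u := insub (index (pblock G x) s).
have cE x i : (index (pblock G x) s == i) = (i <= u) && (x \in nth set0 s i).
  have [le_i|lt_i] := leqP i u.
    rewrite -pblock_nth //; apply/eqP/eqP => [<-|->]; first by rewrite nth_index.
    by rewrite index_uniq // size_s.
  by apply/eqP => E; move: (mem_s x); rewrite -index_mem size_s E ltnNge lt_i.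
apply/(@gddP V 'I_u c); first exact: card_ord.
- move=> l; transitivity #|nth set0 s l|.
    apply: eq_card => x; rewrite !inE -[x \in _]andTb -(ltnW (ltn_ord l)) -cE /c.
    case: insubP => [i _ <-|nlt]; first by rewrite (inj_eq Some_inj) -(inj_eq val_inj).
    by apply/esym/eqP => E; rewrite E ltn_ord in nlt.
  by rewrite card_nth 1?ltnW // /type_gum nth_rcons size_nseq ltn_ord nth_nseq ltn_ord.
- transitivity #|nth set0 s u|.
    apply: eq_card => x; rewrite !inE -[x \in _]andTb -(leqnn u) -cE /c.
    case: insubP => [i lt_i _|]; first by rewrite ltn_eqF.
    rewrite -leqNgt => le_u; apply/esym/eqP/anti_leq.
    by rewrite le_u andbT -ltnS -size_s index_mem mem_s.
  by rewrite card_nth // /type_gum nth_rcons size_nseq ltnn eqxx.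
have cP x y : multipartite c x y = (pblock G x != pblock G y).
  rewrite /multipartite /c; congr negb; apply/eqP/eqP => [|-> //].
  have lt_x z : index (pblock G z) s <= u by rewrite -ltnS -size_s index_mem mem_s.
  case: insubP => [i _ Ei|]; case: insubP => [j _ Ej|] //.
  - by move=> [ij]; apply: (index_inj set0 (mem_s x) (mem_s y)); rewrite -Ei -Ej ij.
  - rewrite -!leqNgt => ge_y ge_x _; apply: (index_inj set0 (mem_s x) (mem_s y)) => /=.
    by apply/eqP; rewrite eqn_leq !(leq_trans (lt_x _)).
have pair_count x y : x != y ->
    count (fun b : {set V} => (x \in b) && (y \in b)) B = multipartite c x y.
  by move=> nxy; rewrite cP; case: eqVneq => [/same|/cross]; apply.
have cardB j : j < size B -> #|nth set0 B j| = 4 by move=> /(mem_nth set0)/sizeB/eqP.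
have enumB (j : 'I_(size B)) : exists e : 'I_4 -> V,
    injective e /\ forall x, x \in nth set0 B j <-> exists k, e k = x.
  have /esym c4 := cardB j (ltn_ord j).
  exists (fun k => enum_val (cast_ord c4 k)); split=> [k k' /enum_val_inj/cast_ord_inj //|x].
  split=> [xb|[k <-]]; last exact: enum_valP.
  by exists (cast_ord (esym c4) (enum_rank_in xb x)); rewrite cast_ordKV enum_rankK_in.
have [e He] := fin_all_exists enumB.
have e_inj j := (He j).1; have memP j := (He j).2.
have in_e j k : e j k \in nth set0 B j by apply/memP; exists k.
exists 'I_(size B), e; split=> //.
- move=> j k k' nk; apply: contraT => NE.
  have := @pair_count (e j k) (e j k'); rewrite (inj_eq (@e_inj j)) nk (negbTE NE).
  move=> /(_ isT) /eqP; rewrite -leqn0 leqNgt -has_count => /negP[]; apply/hasP.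
  by exists (nth set0 B j); rewrite ?mem_nth ?in_e.
- move=> x y nxy Exy; have := pair_count _ _ nxy; rewrite Exy => c1.
  have /hasP [b bB /andP[xb yb]] : has (fun b : {set V} => (x \in b) && (y \in b)) B.
    by rewrite has_count c1.
  have lt_b : index b B < size B by rewrite index_mem.
  have b_eq : nth set0 B (Ordinal lt_b) = b by rewrite nth_index.
  have [k Ek] : exists k, e (Ordinal lt_b) k = x by apply/memP; rewrite b_eq.
  have [k' Ek'] : exists k, e (Ordinal lt_b) k = y by apply/memP; rewrite b_eq.
  by exists (Ordinal lt_b), k, k'.
- move=> j j' k k' l l' nk E1 E2; apply/eqP; apply: contraT => njj.
  have nxy : e j k != e j k' by rewrite (inj_eq (@e_inj j)).
  (* Blocks are positions in [B]: the distinct positions [j] and [j'] would make the count at least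
     2, while [pair_count] allows 0 or 1. *)
  suff : 1 < count (fun b : {set V} => (e j k \in b) && (e j k' \in b)) B.
    by rewrite pair_count //; case: multipartite.
  rewrite -[X in count _ X](mkseq_nth set0) /mkseq count_map -size_filter.
  apply: (@leq_trans (size [:: val j; val j'])) => //; apply: uniq_leq_size.
    by rewrite /= inE andbT val_eqE.
  move=> i; rewrite !inE mem_filter mem_iota /= => /orP[/eqP ->|/eqP ->].
    by rewrite !in_e ltn_ord.
  by rewrite E1 E2 !in_e ltn_ord.
Qed.

(** * Constructions from lines over a finite ring *)

Section Lines.
Local Open Scope ring_scope.
Variables (R : finComUnitRingType) (k : nat) (s : 'I_k -> R).
Hypothesis s_unit : forall i j, i != j -> s i - s j \is a GRing.unit.

(** The points [(i, line a b i)], with the direction [b] as a point of one more group, form the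
    blocks of a transversal design TD(k+1, #|R|). Only unit differences of slopes matter, so [R] may
    be a ring of residues as well as a field. *)
Definition line (a b : R) (i : 'I_k) : R := a + s i * b.

Lemma line_through i j y z : i != j ->
  exists a b, line a b i = y /\ line a b j = z.
Proof.
move=> /s_unit U; pose b := (y - z) / (s i - s j).
exists (y - s i * b), b; rewrite /line subrK; split=> //.
have : (s i - s j) * b = y - z by rewrite mulrC divrK.
by rewrite mulrBl => /eqP; rewrite subr_eq => /eqP ->; ring.
Qed.

Lemma line_inj i j a b a' b' : i != j ->
  line a b i = line a' b' i -> line a b j = line a' b' j -> (a, b) = (a', b').
Proof.
move=> /s_unit U Ei Ej.
have E : (s i - s j) * b = (s i - s j) * b'.
  have : line a b i - line a b j = line a' b' i - line a' b' j by rewrite Ei Ej.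
  by rewrite /line [a + s i * b]addrC [a' + s i * b']addrC !addrKA -!mulrBl.
have bb := mulrI U E; move: Ei; rewrite /line bb => /addIr ->.
by [].
Qed.

Lemma line_const i j a b : i != j -> (line a b i == line a b j) = (b == 0).
Proof.
move=> /s_unit U; rewrite /line (inj_eq (addrI a)) -subr_eq0 -mulrBl.
by rewrite mulrI_eq0 //; apply: mulrI.
Qed.
End Lines.

(** A point of the first [u] groups of the transversal design gets [g] copies, the direction [b]
    gets [m b] points. Two points of different groups fix the line, a point and a direction fix [a];
    since each block meets one direction only, the weights [m b] are independent of each other. *)
Lemma gdd_inflate (R : finComUnitRingType) (u : nat) (s : 'I_u -> R)
    (g : nat) (m : R -> nat) :
  (forall i j, i != j -> (s i - s j)%R \is a GRing.unit) ->
  (forall b, gdd g u (m b)) -> gdd (g * #|R|) u (\sum_b m b).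
Proof.
move=> s_unit Hgdd.
pose X : finType := ('I_g * R)%type; pose M : finType := {b : R & 'I_(m b)}.
have -> : g * #|R| = #|X| by rewrite card_prod card_ord.
have -> : \sum_b m b = #|M|.
  by rewrite card_tagged sumnE big_map big_enum; apply: eq_bigr => b _; rewrite card_ord.
rewrite -[u]card_ord; apply/gdd_sumP.
pose W (ab : R * R) : finType := ('I_g * 'I_u + 'I_(m ab.2))%type.
pose f (ab : R * R) (p : W ab) : (X * 'I_u + M)%type :=
  match p with
  | inl q => inl ((q.1, line s ab.1 ab.2 q.2), q.2)
  | inr z => inr (Tagged (fun b => 'I_(m b)) z)
  end.
apply: (@k4dec_glue _ _ W f (fun ab => multipartite (@gdd_label 'I_g 'I_u 'I_(m ab.2)))).
- move=> [a b] [[x i]|z] [[x' i']|z'] //=.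
  + by case=> -> _ ->.
  + move=> /(congr1 (fun p => if p is inr t then t else Tagged (fun b => 'I_(m b)) z)) /eqP.
    by rewrite /= eq_Tagged => /eqP /= ->.
- by move=> ab; apply: Hgdd.
- by move=> [a b] [[x i]|z] [[x' i']|z'].
- move=> [[[x y] i]|[b z]] [[[x' y'] i']|[b' z']] _ //=.
  + rewrite /multipartite /= => ni.
    have {}ni : i != i' by apply: contraNneq ni => ->.
    have [a [b [E1 E2]]] := line_through s_unit y y' ni.
    by exists (a, b), (inl (x, i)), (inl (x', i')); rewrite /= E1 E2.
  + move=> _; exists (y - s i * b', b')%R, (inl (x, i)), (inr z').
    by rewrite /= /line subrK.
  + move=> _; exists (y' - s i' * b, b)%R, (inr z), (inl (x', i')).
    by rewrite /= /line subrK.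
- move=> [a b] [a' b'] [[x i]|z] [[x' i']|z'] [[t j]|r] [[t' j']|r'] //= _ _;
    rewrite /multipartite /=.
  + move=> ni _ [_ E1 ij] [_ E2 ij']; move: E1 E2; rewrite -ij -ij'; apply: (line_inj s_unit).
    by apply: contraNneq ni => ->.
  + by move=> _ _ [_ E1 ij] [E2 _]; move: E1; rewrite -ij -E2 /line => /addIr ->.
  + by move=> _ _ [E2 _] [_ E1 ij]; move: E1; rewrite -ij -E2 /line => /addIr ->.
Qed.

(** The lines with [b = 0] are the layers, which carry the design with the [m1]
common points; the blocks of the design with [m0] are spread over the other lines. *)
Lemma gdd_combine (R : finComUnitRingType) (s : 'I_4 -> R) (g u m0 m1 : nat) :
  (forall i j, i != j -> (s i - s j)%R \is a GRing.unit) ->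
  gdd g u m0 -> gdd g u m1 -> gdd (g * #|R|) u (m0 * #|R|.-1 + m1).
Proof.
move=> s_unit [J0 [e0 [inj0 sound0 compl0 uniq0]]] [J1 [e1 [inj1 sound1 compl1 uniq1]]].
pose Rs : finType := {b : R | b != 0%R}.
pose X : finType := ('I_g * R)%type; pose M : finType := ('I_m0 * Rs + 'I_m1)%type.
have -> : g * #|R| = #|X| by rewrite card_prod card_ord.
have -> : m0 * #|R|.-1 + m1 = #|M|.
  rewrite card_sum card_prod !card_ord card_sig; congr (_ * _ + _).
  by rewrite -(cardC1 (0%R : R)); apply: eq_card => b; rewrite !inE.
rewrite -[u]card_ord; apply/gdd_sumP.
pose copy (y : R) (p : 'I_g * 'I_u + 'I_m1) : (X * 'I_u + M)%type :=
  match p with inl q => inl ((q.1, y), q.2) | inr z => inr (inr z) end.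
(* The slope belongs to the position [k] of a point in its block, not to its group. Four slopes
   therefore suffice for every [u], which is why #|R| may be smaller than [u]. *)
pose spread (a : R) (b : Rs) (k : 'I_4) (p : 'I_g * 'I_u + 'I_m0) : (X * 'I_u + M)%type :=
  match p with
  | inl q => inl ((q.1, line s a (val b) k), q.2)
  | inr z => inr (inl (z, b)) end.
pose E m := multipartite (@gdd_label 'I_g 'I_u 'I_m).
pose e (j : R * J1 + J0 * (R * Rs)) (k : 'I_4) : (X * 'I_u + M)%type :=
  match j with
  | inl (y, j1) => copy y (e1 j1 k)
  | inr (j0, (a, b)) => spread a b k (e0 j0 k)
  end.
have lab_copy y p : gdd_label (copy y p) = gdd_label p by case: p.
have lab_spread a b k p : gdd_label (spread a b k p) = gdd_label p by case: p.
have copy_inj y : injective (copy y).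
  by move=> [[x i]|z] [[x' i']|z'] //= [-> // ->].
have spread_inj a b k a' b' k' p p' : spread a b k p = spread a' b' k' p' -> p = p'.
  by case: p p' => [[x i]|z] [[x' i']|z'] //= [-> // _ ->].
(* An edge of a layer joins equal heights or uses one of the [m1] common points; an edge on a
   non-constant line does neither. *)
have copy_spread y a b k k' p p' q q' : k != k' ->
    E m0 p p' -> copy y q = spread a b k p -> copy y q' = spread a b k' p' -> False.
  move=> nk; case: p p' q q' => [[x i]|z] [[x' i']|z'] [[t l]|r] [[t' l']|r'] //= _.
  case=> _ Ey _ [_ Ey' _]; have := line_const s_unit a (val b) nk.
  by rewrite -Ey -Ey' eqxx (negbTE (valP b)).
exists (R * J1 + J0 * (R * Rs))%type, e; split.
- move=> [[y j1]|[j0 [a b]]] k k' /=; first by move=> /copy_inj /inj1.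
  by move/spread_inj/inj0.
- move=> [[y j1]|[j0 [a b]]] k k' nk; rewrite /multipartite /= ?lab_copy ?lab_spread.
  + exact: sound1.
  + exact: sound0.
- have from_line (p p' : 'I_g * 'I_u + 'I_m0) v v' : E m0 p p' ->
      (forall k k' : 'I_4, k != k' ->
         exists a b, spread a b k p = v /\ spread a b k' p' = v') ->
      exists j k k', e j k = v /\ e j k' = v'.
    move=> Epp' Hline; have npp : p != p' by apply: contraNneq Epp' => ->.
    have [j [k [k' [Ek Ek']]]] := compl0 _ _ npp Epp'.
    have nk : k != k' by apply: contraNneq npp => kk; rewrite -Ek -Ek' kk.
    have [a [b [H H']]] := Hline _ _ nk.
    by exists (inr (j, (a, b))), k, k'; rewrite /= Ek Ek'.
  have from_copy (p p' : 'I_g * 'I_u + 'I_m1) y : E m1 p p' ->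
      exists j k k', e j k = copy y p /\ e j k' = copy y p'.
    move=> Epp'; have npp : p != p' by apply: contraNneq Epp' => ->.
    have [j [k [k' [Ek Ek']]]] := compl1 _ _ npp Epp'.
    by exists (inl (y, j)), k, k'; rewrite /= Ek Ek'.
  have from_mixed x i y z (b : Rs) (k : 'I_4) : exists a,
      spread a b k (inl (x, i)) = inl ((x, y), i) /\
      forall k', spread a b k' (inr z) = inr (inl (z, b)).
    by exists (y - s k * val b)%R; rewrite /= /line subrK.
  move=> [[[x y] i]|[[z b]|z]] [[[x' y'] i']|[[z' b']|z']] //= _ ni.
  + have [<-|nyy] := eqVneq y y'; first exact: (from_copy (inl (x, i)) (inl (x', i')) y ni).
    apply: (from_line (inl (x, i)) (inl (x', i')) _ _ ni) => k k' nk.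
    have [a [b [E1 E2]]] := line_through s_unit y y' nk.
    have nb : b != 0%R by rewrite -(line_const s_unit a b nk) E1 E2.
    by exists a, (Sub b nb); rewrite /= E1 E2.
  + apply: (from_line (inl (x, i)) (inr z')) => // k k' _.
    by have [a [H H']] := from_mixed x i y z' b' k; exists a, b'.
  + exact: (from_copy (inl (x, i)) (inr z') y ni).
  + apply: (from_line (inr z) (inl (x', i'))) => // k k' _.
    by have [a [H H']] := from_mixed x' i' y' z b k'; exists a, b.
  + exact: (from_copy (inr z) (inl (x', i')) y' ni).
- move=> [[y j1]|[j0 [a b]]] [[y' j1']|[j0' [a' b']]] k k' l l' nk /=.
  (* Adjacent points are not both among the [m1] common ones, and the other point shows the
     layer. *)
  + move=> E1 E2; have yy : y = y'.
      have := sound1 j1 _ _ nk; rewrite /multipartite.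
      case: (e1 j1 k) (e1 j1 k') E1 E2 => [[x i]|z] [[x' i']|z'] //= E1 E2 _.
      * by case: (e1 j1' l) E1 => [[? ?]|?] // [].
      * by case: (e1 j1' l) E1 => [[? ?]|?] // [].
      * by case: (e1 j1' l') E2 => [[? ?]|?] // [].
    move: E1 E2; rewrite -yy => /copy_inj E1 /copy_inj E2.
    by rewrite (uniq1 _ _ _ _ _ _ nk E1 E2).
  + move=> E1 E2; exfalso; have nl : l != l'.
      by apply: contraNneq nk => ll; move: E1; rewrite ll -E2 => /copy_inj/inj1 ->.
    exact: copy_spread nl (sound0 j0' _ _ nl) E1 E2.
  + move=> E1 E2; exfalso.
    exact: copy_spread nk (sound0 j0 _ _ nk) (esym E1) (esym E2).
  + move=> E1 E2; have F1 := spread_inj _ _ _ _ _ _ _ _ E1; have F2 := spread_inj _ _ _ _ _ _ _ _ E2.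
    have jj := uniq0 _ _ _ _ _ _ nk F1 F2; rewrite -jj in E1 E2 F1 F2 *.
    have kl := inj0 _ _ _ F1; have kl' := inj0 _ _ _ F2; rewrite -kl in E1; rewrite -kl' in E2.
    have := sound0 j0 _ _ nk; rewrite /multipartite.
    move: E1 E2; case: (e0 j0 k) (e0 j0 k') => [[x i]|z] [[x' i']|z'] //=.
    * case=> H1 [H2] _; have [-> bb] := line_inj s_unit nk H1 H2.
      by rewrite (val_inj bb).
    * by case=> H1 [bb] _; move: H1; rewrite bb /line => /addIr ->.
    * by case=> bb [H1] _; move: H1; rewrite bb /line => /addIr ->.
Qed.

(** * Filling in groups *)

(** The [g] new points are shared by all fillings and form a group in each, so no block joins them
    to each other or to the [m] old points: together these make one group. For t = 3 the filling is
    a TD(4, g). *)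
Lemma gdd_fill_groups (g t u m : nat) :
  gdd (g * t) u m -> gdd g t g -> gdd g (t * u) (m + g).
Proof.
move=> Hbig Hsmall.
pose L : finType := ('I_t * 'I_u)%type; pose M : finType := ('I_m + 'I_g)%type.
have -> : t * u = #|L| by rewrite card_prod !card_ord.
have -> : m + g = #|M| by rewrite card_sum !card_ord.
rewrite -{1}[g]card_ord; apply/gdd_sumP.
have {}Hbig : k4dec (multipartite (@gdd_label ('I_g * 'I_t)%type 'I_u 'I_m)).
  by apply/gdd_sumP; rewrite card_prod !card_ord.
pose V : finType := ('I_g * L + M)%type.
pose W (i : option 'I_u) : finType :=
  if i is Some _ then ('I_g * 'I_t + 'I_g)%type else (('I_g * 'I_t) * 'I_u + 'I_m)%type.
pose f (i : option 'I_u) : W i -> V :=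
  match i return W i -> V with
  | Some l => fun p => match p with inl q => inl (q.1, (q.2, l)) | inr z => inr (inr z) end
  | None => fun p => match p with inl q => inl (q.1.1, (q.1.2, q.2)) | inr z => inr (inl z) end
  end.
pose D (i : option 'I_u) : rel (W i) :=
  match i return rel (W i) with
  | Some l => multipartite (@gdd_label 'I_g 'I_t 'I_g)
  | None => multipartite (@gdd_label ('I_g * 'I_t)%type 'I_u 'I_m) end.
apply: (@k4dec_glue _ _ W f D).
- by move=> [l|] /= [p|z] [p'|z'] //=; [case: p p' => [? ?] [? ?] /= [-> ->] | case=> -> |
    case: p p' => [[? ?] ?] [[? ?] ?] /= [-> -> ->] | case=> ->].
- by move=> [l|].
- move=> [l|] /= [[x i]|z] [[x' i']|z'] //= _; rewrite /multipartite /=.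
  + by apply: contraNneq => -[->].
  + by apply: contraNneq => -[_ ->].
- move=> [[x [i l]]|[z|z]] [[x' [i' l']]|[z'|z']] //= _; rewrite /multipartite /=.
  + have [<-|nll] := eqVneq l l' => nil.
    * exists (Some l), (inl (x, i)), (inl (x', i')); split=> //=.
      by apply: contraNneq nil => -[->].
    * by exists None, (inl ((x, i), l)), (inl ((x', i'), l')).
  + by move=> _; exists None, (inl ((x, i), l)), (inr z').
  + by move=> _; exists (Some l), (inl (x, i)), (inr z').
  + by move=> _; exists None, (inr z), (inl ((x', i'), l')).
  + by move=> _; exists (Some l'), (inr z), (inl (x', i')).
- have sep l p p' q q' : D None p p' ->
      f (Some l) q = f None p -> f (Some l) q' = f None p' -> False.
    case: p p' q q' => [[[? ?] i]|?] [[[? ?] i']|?] [[? ?]|?] [[? ?]|?] //=.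
    by rewrite /multipartite /= => /negP ni [_ _ E1] [_ _ E2]; apply: ni; rewrite -E1 -E2.
  move=> [l|] [l'|] // w w' r r' _ _ Dw Dr E1 E2.
  + congr Some; move: w w' r r' Dw Dr E1 E2.
    by move=> [[? ?]|?] [[? ?]|?] [[? ?]|?] [[? ?]|?] //= _ _ =>
      [[_ _ ->]|[_ _ ->]|_ [_ _ ->]].
  + by case: (sep _ _ _ _ _ Dr E1 E2).
  + by case: (sep _ _ _ _ _ Dw (esym E1) (esym E2)).
Qed.

(** No edge of the outer design lies inside its exceptional group, which is thus free to carry the
    second design (the piece [true]). *)
Lemma gdd_fill_hole (g u u' m : nat) :
  gdd g u (g * u' + m) -> gdd g u' m -> gdd g (u + u') m.
Proof.
move=> Hbig Hhole.
pose L : finType := ('I_u + 'I_u')%type.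
pose M : finType := ('I_g * 'I_u' + 'I_m)%type.
have -> : u + u' = #|L| by rewrite card_sum !card_ord.
rewrite -[g]card_ord -[m]card_ord; apply/gdd_sumP.
have {}Hbig : k4dec (multipartite (@gdd_label 'I_g 'I_u M)).
  by apply/gdd_sumP; rewrite card_sum card_prod !card_ord.
pose V : finType := ('I_g * L + 'I_m)%type.
pose W (i : bool) : finType :=
  if i then (('I_g * 'I_u' + 'I_m)%type : finType) else (('I_g * 'I_u + M)%type : finType).
pose f (i : bool) : W i -> V :=
  match i return W i -> V with
  | true => fun p => match p with inl q => inl (q.1, inr q.2) | inr z => inr z end
  | false => fun p => match p with
      | inl q => inl (q.1, inl q.2) | inr (inl q) => inl (q.1, inr q.2) | inr (inr z) => inr z end
  end.
pose D (i : bool) : rel (W i) :=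
  match i return rel (W i) with
  | true => multipartite (@gdd_label 'I_g 'I_u' 'I_m)
  | false => multipartite (@gdd_label 'I_g 'I_u M) end.
apply: (@k4dec_glue _ _ W f D).
- move=> [] /=; first by move=> [[? ?]|?] [[? ?]|?] //= [-> // ->].
  by move=> [[? ?]|[[? ?]|?]] [[? ?]|[[? ?]|?]] //= [-> // ->].
- by case.
- move=> [] /=; first by move=> [[x i]|z] [[x' i']|z'].
  move=> [[x i]|[[x i]|z]] [[x' i']|[[x' i']|z']] //= _; rewrite /multipartite //=.
- move=> [[x [i|i]]|z] [[x' [i'|i']]|z'] //= _; rewrite /multipartite /= => ni.
  + by exists false, (inl (x, i)), (inl (x', i')).
  + by exists false, (inl (x, i)), (inr (inl (x', i'))).
  + by exists false, (inl (x, i)), (inr (inr z')).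
  + by exists false, (inr (inl (x, i))), (inl (x', i')).
  + by exists true, (inl (x, i)), (inl (x', i')).
  + by exists true, (inl (x, i)), (inr z').
  + by exists false, (inr (inr z)), (inl (x', i')).
  + by exists true, (inr z), (inl (x', i')).
- have sep p p' q q' : D false p p' ->
      f true q = f false p -> f true q' = f false p' -> False.
    by case: p p' q q' => [[? ?]|[[? ?]|?]] [[? ?]|[[? ?]|?]] [[? ?]|?] [[? ?]|?].
  move=> [] [] // w w' r r' _ _ Dw Dr E1 E2.
  + by case: (sep _ _ _ _ Dr E1 E2).
  + by case: (sep _ _ _ _ Dw (esym E1) (esym E2)).
Qed.

(** * Transversal designs with four groups *)

Lemma unlift_inj (n : nat) (h : 'I_n.+1) : injective (unlift h : 'I_n.+1 -> option 'I_n).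
Proof.
move=> i j; case: (unliftP h i) => [i' ->|->]; case: (unliftP h j) => [j' ->|->];
  by rewrite ?liftK ?unlift_none // => -[->].
Qed.

(** Type n^3 n^1 has four equal groups: it is a TD(4, n), that is, a pair of orthogonal Latin
    squares of order n. The symmetric form indexes the groups by ['I_4]; [unlift ord0] singles out
    the exceptional one. *)
Lemma gdd_squareP (T : finType) :
  gdd #|T| 3 #|T| <-> k4dec (multipartite (fun p : 'I_4 * T => p.1)).
Proof.
pose c (p : 'I_4 * T) : option 'I_3 := unlift ord0 p.1.
have card_c (i : 'I_4) : #|[pred p | c p == unlift ord0 i]| = #|T|.
  rewrite -(card_image (f := fun x : T => (i, x))); last by move=> x y [].
  apply: eq_card => -[j x]; rewrite !inE /c /=.
  apply/eqP/imageP => [/unlift_inj ->|[y _ [-> _]] //].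
  by exists x.
have P : gdd #|T| 3 #|T| <-> k4dec (multipartite c).
  apply: gddP; first exact: card_ord.
  - by move=> l; rewrite -(card_c (lift ord0 l)) liftK.
  - by rewrite -(card_c ord0) unlift_none.
have cE x y : multipartite c x y = multipartite (fun p : 'I_4 * T => p.1) x y.
  by rewrite /multipartite /c (inj_eq (@unlift_inj _ _)).
split.
- by move/P; apply: k4dec_bij (@inj_id _) (leqnn _) _ => x y.
- by move=> H; apply/P; apply: k4dec_bij (@inj_id _) (leqnn _) _ H => x y.
Qed.

(** The product of transversal designs: with constant weight [n] the directions make up a fourth
    group as large as the other three. *)
Lemma gdd_inflate_square (R : finComUnitRingType) (s : 'I_3 -> R) (n : nat) :
  (forall i j, i != j -> (s i - s j)%R \is a GRing.unit) ->
  gdd n 3 n -> gdd (n * #|R|) 3 (n * #|R|).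
Proof.
move=> s_unit Hn; have := gdd_inflate s_unit (m := fun=> n) (fun=> Hn).
by rewrite sum_nat_const mulnC.
Qed.

Lemma gdd_square1 : gdd 1 3 1.
Proof.
have /iffRL := gdd_squareP unit; rewrite card_unit; apply.
apply: (@k4dec_bij _ _ _ _ (fun i : 'I_4 => (i, tt)) _ _ _ k4dec_clique) => //.
- by move=> i j [].
- by rewrite card_prod card_unit muln1.
Qed.

Lemma field_slopes (F : finFieldType) (k : nat) : k <= #|F| ->
  exists s : 'I_k -> F, forall i j, i != j -> (s i - s j)%R \is a GRing.unit.
Proof.
move=> le_k; exists (fun i => enum_val (widen_ord le_k i)) => i j nij.
by rewrite unitfE subr_eq0 (inj_eq enum_val_inj) -val_eqE.
Qed.

Lemma Zp_slopes (n k : nat) : 1 < n -> (forall d, 0 < d < k -> coprime n d) ->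
  forall i j : 'I_k, i != j -> (i%:R - j%:R : 'Z_n)%R \is a GRing.unit.
Proof.
move=> n1 Hco; have lt_case (i j : 'I_k) : i < j -> (j%:R - i%:R : 'Z_n)%R \is a GRing.unit.
  move=> lt_ij; rewrite -natrB ?(ltnW lt_ij) // unitZpE // Hco //.
  by rewrite subn_gt0 lt_ij (leq_ltn_trans (leq_subr _ _)).
move=> i j; rewrite -val_eqE /= neq_ltn => /orP[/lt_case|/lt_case //].
by rewrite -opprB unitrN.
Qed.

Lemma finField_card (p k : nat) : prime p -> 0 < k ->
  exists F : finFieldType, #|F| = p ^ k.
Proof. by move=> pp k0; have [F _ cardF] := pPrimePowerField pp k0; exists F. Qed.

Lemma gdd_square_odd (n o : nat) : coprime o 2 -> gdd n 3 n -> gdd (n * o) 3 (n * o).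
Proof.
(* ['Z_o] has at least two elements even for o = 1, which is therefore treated apart. *)
move=> oddo Hn; have [o1|o1] := leqP o 1.
  by case: o o1 oddo => [|[|o]] // _ _; rewrite !muln1.
have -> : o = #|'Z_o| by rewrite card_ord Zp_cast.
apply: gdd_inflate_square (Zp_slopes o1 _) Hn => d.
by case: d => [|[|[|]]] //=; rewrite ?coprimen1.
Qed.

(** All four groups come from slopes; leaving out the line a = b = 0 removes exactly the block of
    the four points [(i, 0)]. *)
Lemma gdd_square_incomplete (F : finFieldType) : 4 <= #|F| ->
  k4dec (fun p q : 'I_4 * F =>
    (p.1 != q.1) && ~~ ((p.2 == 0%R) && (q.2 == 0%R))).
Proof.
move=> /field_slopes [s s_unit].
exists {ab : F * F | ab != (0%R, 0%R)}, (fun ab i => (i, line s (val ab).1 (val ab).2 i)); split.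
- by move=> j i i' [].
- move=> [[a b] /= nab] i j nij; rewrite nij /=; apply: contra nab => /andP[/eqP Ei /eqP Ej].
  apply/eqP; apply: (line_inj s_unit nij); rewrite ?Ei ?Ej /line; by rewrite mulr0 addr0.
- move=> [i x] [j y] _ /= /andP[nij nxy].
  have [a [b [E1 E2]]] := line_through s_unit x y nij.
  have nab : (a, b) != (0, 0)%R.
    apply: contra nxy => /eqP[a0 b0]; rewrite -E1 -E2 a0 b0 /line !mulr0 addr0 eqxx //.
  by exists (Sub (a, b) nab), i, j; rewrite /= E1 E2.
- move=> [[a b] ?] [[a' b'] ?] i j l l' nij /= [E1 E2] [E3 E4]; apply: val_inj => /=.
  by subst l l'; apply: (line_inj s_unit nij).
Qed.

(** Wilson's construction: the points of the first four groups of a TD(5, t) get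
weight 3, [w] points of the fifth group are kept.  A block through a kept point is
filled with a TD(4, 4) minus a block, any other block with a TD(4, 3). *)
Lemma gdd_square_wilson (R : finComUnitRingType) (s : 'I_4 -> R) (w : nat) :
  (forall i j, i != j -> (s i - s j)%R \is a GRing.unit) ->
  w <= #|R| -> gdd w 3 w -> gdd (#|R| * 3 + w) 3 (#|R| * 3 + w).
Proof.
move=> s_unit le_w Hw.
(* The field of order 4 carries the TD(4, 4) minus a block: 0 stands for the kept point, the three
   nonzero elements [Fs] index the copies of an ordinary point. *)
have [F cardF] := finField_card (isT : prime 2) (isT : 0 < 2).
pose Fs : finType := {x : F | x != 0%R}.
have cardFs : #|Fs| = 3.
  rewrite card_sig; have := cardC1 (0%R : F); rewrite cardF /= => <-.
  by apply: eq_card => b; rewrite !inE.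
pose T : finType := (R * Fs + 'I_w)%type.
have -> : #|R| * 3 + w = #|T| by rewrite card_sum card_prod card_ord cardFs.
apply/gdd_squareP.
have H3 : k4dec (multipartite (fun p : 'I_4 * Fs => p.1)).
  apply/gdd_squareP; rewrite cardFs -[3]mul1n.
  exact: gdd_square_odd _ gdd_square1.
have {}Hw : k4dec (multipartite (fun p : 'I_4 * 'I_w => p.1)).
  by apply/gdd_squareP; rewrite card_ord.
have H4 := @gdd_square_incomplete F (eq_leq (esym cardF)).
pose emb (z : 'I_w) : R := enum_val (widen_ord le_w z).
have emb_inj : injective emb by move=> z z' /enum_val_inj [] /val_inj.
pose C : finType := {b : R | b \notin codom emb}.
pose V : finType := ('I_4 * T)%type.
(* The fifth group consists of the directions. [inl z] marks blocks with a kept direction, [inr b]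
   those with a dropped one, and [None] the TD(4, w) on the kept points. *)
pose W (i : option (R * ('I_w + C))) : finType :=
  match i with
  | Some (a, inl z) => ('I_4 * F)%type
  | Some (a, inr b) => ('I_4 * Fs)%type
  | None => ('I_4 * 'I_w)%type
  end.
pose f (i : option (R * ('I_w + C))) : W i -> V :=
  match i return W i -> V with
  | Some (a, inl z) => fun p =>
      (p.1, if insub p.2 is Some x then inl (line s a (emb z) p.1, x) else inr z)
  | Some (a, inr b) => fun p => (p.1, inl (line s a (val b) p.1, p.2))
  | None => fun p => (p.1, inr p.2)
  end.
pose D (i : option (R * ('I_w + C))) : rel (W i) :=
  match i return rel (W i) with
  | Some (a, inl z) => fun p q => (p.1 != q.1) && ~~ ((p.2 == 0%R) && (q.2 == 0%R))
  | Some (a, inr b) => multipartite (fun p : 'I_4 * Fs => p.1)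
  | None => multipartite (fun p : 'I_4 * 'I_w => p.1)
  end.
(* A piece other than [None] is determined by its line, so uniqueness of the piece reduces to
   recovering the line from two points. *)
pose slope (i : option (R * ('I_w + C))) : option (R * R) :=
  match i with
  | Some (a, inl z) => Some (a, emb z)
  | Some (a, inr b) => Some (a, val b)
  | None => None
  end.
have slope_inj : injective slope.
  move=> [[a [z|b]]|] [[a' [z'|b']]|] //= [-> //].
  - by move=> /emb_inj ->.
  - by move=> E; case/negP: (valP b'); rewrite /= -E codom_f.
  - by move=> E; case/negP: (valP b); rewrite /= E codom_f.
  - by move=> /val_inj ->.
have f_inl i q j y x : f i q = (j, inl (y, x)) ->
    exists a b, slope i = Some (a, b) /\ line s a b j = y.
  case: i q => [[a [z|b]]|] [j' v] //=.
  - by case: insubP => // x' _ _ [<- Ey _]; exists a, (emb z).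
  - by case=> <- Ey _; exists a, (val b).
have f_inr i q j z : f i q = (j, inr z) ->
    slope i = None \/ exists a, slope i = Some (a, emb z).
  case: i q => [[a [z'|b]]|] [j' v] //=.
  - by case: insubP => // _ [_ <-]; right; exists a.
  - by left.
have D_group i q q' : D i q q' -> (f i q).1 != (f i q').1.
  by case: i q q' => [[a [z|b]]|] [j v] [j' v'] //= /andP[].
(* In a TD(4, 4) minus a block both kept points would be at 0, where the edges were removed; only
   [None] joins them. *)
have f_inr2 i q q' j j' z z' : D i q q' ->
    f i q = (j, inr z) -> f i q' = (j', inr z') -> i = None.
  case: i q q' => [[a [t|b]]|] [k v] [k' v'] //= /andP[_ nvv].
  case: insubP => [//|/negPn v0] _; case: insubP => [//|/negPn v0'] _.
  by rewrite v0 v0' in nvv.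
apply: (@k4dec_glue _ _ W f D).
- move=> [[a [z|b]]|] [i x] [i' x'] /=.
  + by case=> <-; case: insubP => [y _ <-|/negPn/eqP ->];
      case: insubP => [y' _ <-|/negPn/eqP ->] // [->].
  + by case=> -> _ ->.
  + by case=> -> ->.
- by move=> [[a [z|b]]|].
- by move=> i q q' _; apply: D_group.
- have point a b i y x : line s a b i = y ->
      exists J q, slope J = Some (a, b) /\ f J q = (i, inl (y, x)).
    move=> <-; case: (boolP (b \in codom emb)) => [/codomP [z bz]|nb].
      exists (Some (a, inl z)), (i, val x); rewrite /= bz; split=> //.
      by rewrite valK.
    by exists (Some (a, inr (Sub b nb))), (i, x).
  move=> [i [[y x]|z]] [i' [[y' x']|z']] _ /=; rewrite /multipartite /= => ni.
  + have [a [b [E1 E2]]] := line_through s_unit y y' ni.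
    have [J [q [SJ fw]]] := point _ _ _ _ x E1.
    have [J' [q' [SJ' fw']]] := point _ _ _ _ x' E2.
    have JJ : J = J' by apply: slope_inj; rewrite SJ.
    subst J'; exists J, q, q'; split=> //.
    have: (f J q).1 != (f J q').1 by rewrite fw fw'.
    move: q q' fw fw' {SJ SJ'}.
    case: J => [[a' [z'|b']]|] [k v] [k' v'] //= fw fw' -> //=.
    by case: insubP fw => // ? nv _ _; rewrite (negbTE nv).
  + exists (Some (y - s i * emb z', inl z'))%R, (i, val x), (i', 0%R).
    by rewrite /= ni valK insubN ?eqxx // (negbTE (valP x)) /line subrK.
  + exists (Some (y' - s i' * emb z, inl z))%R, (i, 0%R), (i', val x').
    by rewrite /= ni valK insubN ?eqxx // (negbTE (valP x')) /line subrK.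
  + by exists None, (i, z), (i', z').
- move=> I I' q q' t t' nw nt Dw Dt E1 E2.
  have := D_group _ _ _ Dw; rewrite E1 E2.
  move: E1 E2; case F1: (f I' t) => [i [[y x]|z]];
    case F2: (f I' t') => [i' [[y' x']|z']] E1 E2 /= ni.
  + have [a [b [S1 L1]]] := f_inl _ _ _ _ _ E1; have [a2 [b2 [S2 L2]]] := f_inl _ _ _ _ _ E2.
    have [c [d [S3 L3]]] := f_inl _ _ _ _ _ F1; have [c2 [d2 [S4 L4]]] := f_inl _ _ _ _ _ F2.
    move: S2 S4; rewrite S1 S3 => -[? ?] [? ?]; subst a2 b2 c2 d2.
    apply: slope_inj; rewrite S1 S3; congr Some.
    by apply: (line_inj s_unit ni); rewrite ?L1 ?L2.
  + have [a [b [S1 L1]]] := f_inl _ _ _ _ _ E1; have [c [d [S3 L3]]] := f_inl _ _ _ _ _ F1.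
    have [|[a2 S2]] := f_inr _ _ _ _ E2; first by rewrite S1.
    have [|[c2 S4]] := f_inr _ _ _ _ F2; first by rewrite S3.
    move: S2 S4; rewrite S1 S3 => -[? ?] [? ?]; subst a2 b c2 d.
    apply: slope_inj; rewrite S1 S3; move: L1; rewrite -L3 /line => /addIr -> //.
  + have [a [b [S1 L1]]] := f_inl _ _ _ _ _ E2; have [c [d [S3 L3]]] := f_inl _ _ _ _ _ F2.
    have [|[a2 S2]] := f_inr _ _ _ _ E1; first by rewrite S1.
    have [|[c2 S4]] := f_inr _ _ _ _ F1; first by rewrite S3.
    move: S2 S4; rewrite S1 S3 => -[? ?] [? ?]; subst a2 b c2 d.
    apply: slope_inj; rewrite S1 S3; move: L1; rewrite -L3 /line => /addIr -> //.
  + by rewrite (f_inr2 _ _ _ _ _ _ _ Dw E1 E2) (f_inr2 _ _ _ _ _ _ _ Dt F1 F2).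
Qed.

(** If 4 divides g, multiply a field of order 2^a by an odd factor. Otherwise write g = 3t + w with
    t > 1 prime to 6 and w <= t: the slopes 0, 1, 2, 3 are good modulo t, and w is odd because g is
    even and t odd, so a TD(4, w) is at hand. Any such t is at least 5, so 10 and 14 are out of
    reach and enter as hypotheses. *)
Lemma gdd_square_even (g : nat) :
  gdd 10 3 10 -> gdd 14 3 14 -> ~~ odd g -> ~~ (3 %| g) -> 2 < g -> gdd g 3 g.
Proof.
move=> H10 H14 even_g g3 g2; have g0 : 0 < g by lia.
have Hodd w : odd w -> gdd w 3 w.
  by move=> oddw; rewrite -[w]mul1n; apply: gdd_square_odd gdd_square1; rewrite coprimen2.
have [g4|g4] := boolP (4 %| g).
  have a2 : 1 < logn 2 g by rewrite -(@pfactor_dvdn 2 2).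
  have [F cardF] := finField_card (isT : prime 2) (ltnW a2).
  have le3 : 3 <= #|F|.
    by rewrite cardF (leq_trans (isT : 3 <= 2 ^ 2)) // leq_exp2l.
  have [s s_unit] := field_slopes le3.
  have := gdd_inflate_square s_unit gdd_square1; rewrite mul1n cardF => HF.
  have <- : 2 ^ logn 2 g * g`_2^' = g by rewrite -p_part partnC.
  apply: gdd_square_odd HF.
  by have := coprime_partC 2 g g; rewrite p_part coprime_pexpl ?(ltnW a2) // coprime_sym.
have [->//|n10] := eqVneq g 10; have [->//|n14] := eqVneq g 14.
have [t [t1 t2 t3 le1 le2]] :
    exists t, [/\ 1 < t, coprime t 2, coprime t 3, 3 * t <= g & g <= 4 * t].
  have reduce t : 1 < t -> t %% 6 \in [:: 1; 5] -> 3 * t <= g -> g <= 4 * t ->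
      exists t, [/\ 1 < t, coprime t 2, coprime t 3, 3 * t <= g & g <= 4 * t].
    move=> t1 t6 le1 le2; exists t; split=> //.
    - by rewrite coprimen2; move: t6; rewrite !inE; lia.
    - by rewrite coprime_sym prime_coprime //; move: t6; rewrite !inE; lia.
  (* The intervals [3t, 4t] for t = 7, 11, 13 are [21, 28], [33, 44], [39, 52]; the values 6, 18, 30
     that they miss are multiples of 3. *)
  have [lt48|le48] := ltnP g 48.
    have [?|?] := leqP g 28; first by apply: (reduce 7) => //; lia.
    have [?|?] := leqP g 44; first by apply: (reduce 11) => //; lia.
    by apply: (reduce 13) => //; lia.
  have q_eq := divn_eq (g %/ 3) 6; have r6 : g %/ 3 %% 6 < 6 by rewrite ltn_pmod.
  have q_ge : g < 3 * (g %/ 3) + 3 by lia.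
  have q_le : 3 * (g %/ 3) <= g by lia.
  move: (g %/ 3) (g %/ 3 %/ 6) (g %/ 3 %% 6) q_eq r6 q_ge q_le => q c r -> r6 q_ge q_le.
  (* The list gives the distance from q = g / 3 down to the nearest number congruent to 1 or 5
     modulo 6. It is at most 3, and q >= 16 yields g <= 3q + 2 <= 4(q - 3). *)
  apply: (reduce (c * 6 + r - nth 0 [:: 1; 0; 1; 2; 3; 0] r));
    case: r r6 q_ge q_le => [|[|[|[|[|[|r]]]]]] //= _ q_ge q_le; rewrite ?inE; lia.
have s_unit : forall i j : 'I_4, i != j -> (i%:R - j%:R : 'Z_t)%R \is a GRing.unit.
  by apply: Zp_slopes => // -[|[|[|[|d]]]] //; rewrite coprimen1.
have := gdd_square_wilson (w := g - 3 * t) s_unit.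
rewrite card_ord Zp_cast // [t * 3]mulnC subnKC //; apply; first by rewrite leq_subLR addnC -mulSn.
apply: Hodd; rewrite oddB // (negbTE even_g) oddM /=.
by move: t2; rewrite coprimen2 => ->.
Qed.

(** * Reaching every multiple of 3 and every group size 6h *)

(** Greedy filling: full shares [K] as long as possible, then the rest; truncated subtraction makes
    all later shares 0. *)
Lemma sum_truncated (p K n : nat) : n <= p * K ->
  \sum_(i < p) minn K (n - i * K) = n.
Proof.
elim: p n => [|p IHp] n le_n; first by rewrite big_ord0; lia.
rewrite big_ord_recl /= mul0n subn0.
have [le_nK|lt_Kn] := leqP n K.
  rewrite big1 ?addn0 // => i _; rewrite /bump /=; lia.
rewrite -[RHS](subnKC (ltnW lt_Kn)) -[in RHS](IHp (n - K)); last by lia.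
by congr (_ + _); apply: eq_bigr => i _; congr minn; rewrite /bump /=; lia.
Qed.

Lemma gdd_inflate_all (p g u K : nat) : prime p -> u <= p ->
  (forall n, n <= K -> gdd g u (3 * n)) ->
  forall n, n <= K * p -> gdd (g * p) u (3 * n).
Proof.
move=> pp le_up HK n le_n.
have [F cardF] := finField_card pp (isT : 0 < 1); rewrite expn1 in cardF.
have le_u : u <= #|F| by rewrite cardF.
have [s s_unit] := field_slopes le_u.
pose m (b : F) := 3 * minn K (n - enum_rank b * K).
have := gdd_inflate s_unit (m := m) (fun b => HK _ (geq_minl _ _)).
rewrite cardF /m -big_distrr /= (reindex _ (onW_bij _ (enum_val_bij F))) /=.
under eq_bigr do rewrite enum_valK.
by rewrite cardF sum_truncated // mulnC.
Qed.

(** With q = p^k, write n = n0 (q-1) + n1 by dividing by q-1 and capping [n0] at [K]. Below the cap,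
    n1 is a remainder, at most q-2 <= K by [p ^ k <= K.+2]; at the cap, n1 = n - K(q-1) <= K. *)
Lemma gdd_combine_all (p k g u K : nat) : prime p -> 3 < p ^ k -> p ^ k <= K.+2 ->
  (forall n, n <= K -> gdd g u (3 * n)) ->
  forall n, n <= K * p ^ k -> gdd (g * p ^ k) u (3 * n).
Proof.
move=> pp q3 qK HK n le_n.
have k0 : 0 < k by case: k q3 {qK le_n}.
have [F cardF] := finField_card pp k0.
have le4 : 4 <= #|F| by rewrite cardF.
have [s s_unit] := field_slopes le4.
set q := p ^ k in q3 qK le_n cardF *.
pose n0 := minn K (n %/ q.-1); pose n1 := n - n0 * q.-1.
have n0K : n0 * q.-1 <= n.
  by rewrite (leq_trans _ (leq_divM n q.-1)) // leq_mul2r geq_minr orbT.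
have n1K : n1 <= K.
  rewrite /n1 /n0; case: (leqP K (n %/ q.-1)) => [le_K|lt_K].
    by move: le_n; case: q q3 {qK n1 n0 n0K cardF le_K} => // q _; rewrite mulnS /=; lia.
  rewrite {1}(divn_eq n q.-1) addKn -ltnS (leq_trans (ltn_pmod _ _)) //; lia.
have := gdd_combine s_unit (HK n0 (geq_minl _ _)) (HK n1 n1K).
rewrite cardF; congr gdd; rewrite /n1; lia.
Qed.

(** Strong induction, dividing [h] by 4 or by a prime p >= 5. A single factor 2 cannot be split off,
    because the field of order 2 has fewer than the four slopes that [gdd_combine] uses; hence the
    second base case h = 2. *)
Lemma gdd_closure (u h : nat) : 5 <= u -> 0 < h -> ~~ (3 %| h) ->
  (forall n, n <= u.-1 -> gdd 6 u (3 * n)) ->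
  (forall n, n <= 2 * u.-1 -> gdd 12 u (3 * n)) ->
  forall n, n <= h * u.-1 -> gdd (6 * h) u (3 * n).
Proof.
move=> u5 h0 h3 H6 H12; elim/ltn_ind: h h0 h3 => h IH h0 h3.
have [->|h1] := eqVneq h 1; first by rewrite mul1n.
have [->|h2] := eqVneq h 2; first by [].
have hq_gt0 q : q %| h -> 0 < h %/ q.
  by move=> qh; rewrite divn_gt0; [apply: dvdn_leq | apply: dvdn_gt0 qh].
have step q : q %| h -> 1 < q ->
    ((forall n, n <= h %/ q * u.-1 -> gdd (6 * (h %/ q)) u (3 * n)) ->
      forall n, n <= h %/ q * u.-1 * q -> gdd (6 * (h %/ q) * q) u (3 * n)) ->
    forall n, n <= h * u.-1 -> gdd (6 * h) u (3 * n).
  move=> qh q1 Hq n; have h_eq := divnK qh.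
  have lt_hq : h %/ q < h by rewrite ltn_Pdiv.
  have hq3 : ~~ (3 %| h %/ q).
    by apply: contra h3 => d3; rewrite -h_eq; apply: dvdn_mulr.
  have := Hq (IH _ lt_hq (hq_gt0 _ qh) hq3) n.
  by rewrite [_ * u.-1 * q]mulnAC h_eq -mulnA h_eq.
have [h4|h4] := boolP (4 %| h).
  apply: (step 4) => //; apply: (@gdd_combine_all 2 2) => //.
  by have := hq_gt0 _ h4; nia.
(* As 4 does not divide [h] and [h] is neither 1 nor 2, its odd part exceeds 1; the least prime
   factor of that part is odd and not 3. *)
have [p [pp ph p5]] : exists p, [/\ prime p, p %| h & 4 < p].
  pose o := h`_2^'.
  have h2o : h = 2 ^ logn 2 h * o by rewrite -p_part partnC.
  have l2 : logn 2 h <= 1.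
    by rewrite leqNgt; apply: contra h4 => l2; rewrite (@pfactor_dvdn 2 2).
  have o1 : 1 < o.
    have o0 : 0 < o by rewrite part_gt0.
    rewrite ltn_neqAle o0 andbT; apply/eqP => o1; move: h1 h2.
    by rewrite h2o -o1 muln1; case: (logn 2 h) l2 => [|[]].
  exists (pdiv o); split.
  - exact: pdiv_prime.
  - by rewrite h2o dvdn_mull // pdiv_dvd.
  - have ppr := pdiv_prime o1; have pdo := pdiv_dvd o.
    have : pdiv o != 2.
      by have := pnat_dvd pdo (part_pnat _ _); rewrite pnatE // !inE.
    have : pdiv o != 3.
      by apply: contraNneq h3 => <-; rewrite h2o dvdn_mull.
    have : pdiv o != 4 by apply: contraTneq ppr => ->.
    by have := prime_gt1 ppr; case: (pdiv o) => [|[|[|[|[|]]]]].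
have p1 := prime_gt1 pp.
have [le_up|lt_pu] := leqP u p.
  by apply: (step p) => //; apply: gdd_inflate_all.
(* Here K = (h/p)(u-1) >= u-1 >= p, so the bound p <= K + 2 holds. *)
apply: (step p) => //; rewrite -{2 4}[p]expn1.
apply: gdd_combine_all => //; rewrite expn1; first exact: ltnW.
by have := hq_gt0 _ ph; nia.
Qed.

(** * Designs with a cyclic automorphism group *)

(** The group Z_v acts by x -> x + 1 on [r] orbits of length [v] and, inside the group
of size m, on orbits of lengths [lens]; the point x of the orbit o is [(o, x)].  The
other groups are given by the pairs (o %/ a, x %% b). *)
Section CyclicDesign.
Variables (v r a b : nat) (lens : seq nat) (blocks : seq (seq (nat * nat))).

(** The default 1 keeps the length a positive divisor of [v] for every [o], even beyond the listed
    orbits. *)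
Definition orbit_len (o : nat) := if o < r then v else nth 1 lens (o - r).

Definition cyclic_points : seq (nat * nat) :=
  [seq (o, x) | o <- iota 0 (r + size lens), x <- iota 0 (orbit_len o)].

(** The pair naming a group is coded in base [b]; the successor leaves 0 to the exceptional
    group. *)
Definition cyclic_label (p : nat * nat) : nat :=
  if p.1 < r then (p.1 %/ a * b + p.2 %% b).+1 else 0.

Definition shift (k : nat) (p : nat * nat) := (p.1, (p.2 + k) %% orbit_len p.1).

(** The translate of [B] that moves its point [p] to [(o, 0)] contributes its other points: these
    are the classical pure and mixed differences. *)
Definition block_differences (o : nat) (B : seq (nat * nat)) : seq (nat * nat) :=
  flatten [seq [seq shift (v - p.2) q | q <- B & q != p] | p <- B & p.1 == o].

Definition differences (o : nat) : seq (nat * nat) :=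
  flatten [seq block_differences o B | B <- blocks].

Definition lex_le (p q : nat * nat) := (p.1 < q.1) || (p.1 == q.1) && (p.2 <= q.2).

Definition good_block (B : seq (nat * nat)) : bool :=
  [&& size B == 4, uniq B,
      all (fun p => (p.1 < r + size lens) && (p.2 < orbit_len p.1)) B &
      count (fun p => r <= p.1) B <= 1].

(** By invariance it is enough to look at the blocks through the points [(o, 0)]. *)
Definition difference_check : bool :=
  [&& 0 < v, b %| v, all (fun t => (0 < t) && (t %| v)) lens, all good_block blocks &
      all (fun o => sort lex_le (differences o) ==
             [seq p <- cyclic_points | cyclic_label p != cyclic_label (o, 0)])
          (iota 0 r)].

Definition profile_check (g u m : nat) : bool :=
  [&& all (fun p => cyclic_label p <= u) cyclic_points,
      all (fun l => count (fun p => cyclic_label p == l) cyclic_points == g) (iota 1 u) &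
      count (fun p => cyclic_label p == 0) cyclic_points == m].

Lemma mem_cyclic_points p :
  (p \in cyclic_points) = (p.1 < r + size lens) && (p.2 < orbit_len p.1).
Proof.
apply/idP/idP => [/allpairsPdep [o [x []]]|/andP[lt_o lt_x]].
  by rewrite !mem_iota => ? ? -> /=; apply/andP.
apply/allpairsPdep; exists p.1, p.2; rewrite !mem_iota.
by case: p lt_o lt_x.
Qed.

Lemma uniq_cyclic_points : uniq cyclic_points.
Proof.
apply: allpairs_uniq_dep; [exact: iota_uniq | by move=> o _; exact: iota_uniq |].
by move=> [o x] [o' x'] _ _ [-> ->].
Qed.

(** Applied twice to the list of differences: a value occurring once reveals first its base block,
    then the point of that block taken as origin. *)
Lemma uniq_flatten_nth (T : eqType) (ss : seq (seq T)) i j x :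
  uniq (flatten ss) -> i < size ss -> j < size ss ->
  x \in nth [::] ss i -> x \in nth [::] ss j -> i = j.
Proof.
elim: ss i j => // s ss IH [|i] [|j] //=; rewrite cat_uniq => /and3P[_ /hasPn disj uniq_ss].
- move=> _ lt_j xs xj; have /disj : x \in flatten ss.
    by apply/flattenP; exists (nth [::] ss j); rewrite ?mem_nth.
  by rewrite /= xs.
- move=> lt_i _ xi xs; have /disj : x \in flatten ss.
    by apply/flattenP; exists (nth [::] ss i); rewrite ?mem_nth.
  by rewrite /= xs.
- by move=> lt_i lt_j xi xj; congr _.+1; apply: IH xi xj.
Qed.

Lemma uniq_flatten_mem (T : eqType) (ss : seq (seq T)) s :
  uniq (flatten ss) -> s \in ss -> uniq s.
Proof.
elim: ss => //= s' ss IH; rewrite cat_uniq inE => /and3P[us' _ uss].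
by case/predU1P=> [->|/(IH uss)].
Qed.

Hypothesis check : difference_check.

Let v_gt0 : 0 < v. Proof. by case/and5P: check. Qed.
Let b_dvd_v : b %| v. Proof. by case/and5P: check. Qed.

Lemma orbit_len_dvd o : (0 < orbit_len o) && (orbit_len o %| v).
Proof.
rewrite /orbit_len; case: ifP => _; first by rewrite v_gt0 dvdnn.
have [lt_o|ge_o] := ltnP (o - r) (size lens); last by rewrite nth_default ?dvd1n.
by case/and5P: check => _ _ /allP H _ _; apply: H; rewrite mem_nth.
Qed.

Lemma orbit_len_gt0 o : 0 < orbit_len o.
Proof. by case/andP: (orbit_len_dvd o). Qed.

Lemma shift_shift j k p : shift j (shift k p) = shift (k + j) p.
Proof. by rewrite /shift /= modnDml addnA. Qed.

Lemma shift_multiple k p : v %| k -> p.2 < orbit_len p.1 -> shift k p = p.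
Proof.
case/andP: (orbit_len_dvd p.1) => _ len_v /(dvdn_trans len_v) /eqP k0 lt_p.
by rewrite /shift -modnDmr k0 addn0 modn_small // -surjective_pairing.
Qed.

Lemma shift_mod k p : shift (k %% v) p = shift k p.
Proof.
by rewrite /shift -modnDmr modn_dvdm ?modnDmr //; case/andP: (orbit_len_dvd p.1).
Qed.

Lemma shift_points k p : p \in cyclic_points -> shift k p \in cyclic_points.
Proof. by rewrite !mem_cyclic_points /= => /andP[-> _]; rewrite ltn_pmod ?orbit_len_gt0. Qed.

(** Translations permute the groups: as [b] divides [v], reduction modulo [v] respects residues
    modulo [b], and the code in base [b] separates its two digits. *)
Lemma eq_label_shift k p q :
  (cyclic_label (shift k p) == cyclic_label (shift k q)) =
  (cyclic_label p == cyclic_label q).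
Proof.
have b0 : 0 < b by apply: dvdn_gt0 b_dvd_v.
rewrite /cyclic_label /= /orbit_len; case: (ltnP p.1 r) => _; case: (ltnP q.1 r) => _ //=.
rewrite !eqSS !modn_dvdm //.
have Emod x y : (x %% b == y %% b) = ((x + k) %% b == (y + k) %% b) by rewrite eqn_modDr.
have Hdm n x : (n * b + x %% b) %/ b = n /\ (n * b + x %% b) %% b = x %% b.
  by rewrite divnMDl // divn_small ?ltn_pmod // addn0 modnMDl modn_mod.
have Esum n n' x x' : (n * b + x %% b == n' * b + x' %% b) = (n == n') && (x %% b == x' %% b).
  apply/eqP/andP => [E|[/eqP -> /eqP -> //]].
  have [E1 E2] := Hdm n x; have [E3 E4] := Hdm n' x'.
  by split; apply/eqP; [rewrite -[LHS]E1 E | rewrite -[LHS]E2 E].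
by rewrite !Esum -Emod.
Qed.

(** The check equates a sorted list with a list free of repetitions. This gives coverage here, and
    multiplicity one in [uniq_differences]. *)
Lemma mem_differences o q : o < r ->
  (q \in differences o) = (q \in cyclic_points) && (cyclic_label q != cyclic_label (o, 0)).
Proof.
move=> lt_o; case/and5P: check => _ _ _ _ /allP /(_ o).
rewrite mem_iota => /(_ lt_o) /eqP E.
by rewrite -(mem_sort lex_le) E mem_filter andbC.
Qed.

Lemma uniq_differences o : o < r -> uniq (differences o).
Proof.
move=> lt_o; case/and5P: check => _ _ _ _ /allP /(_ o).
rewrite mem_iota => /(_ lt_o) /eqP E.
by rewrite -(sort_uniq lex_le) E filter_uniq // uniq_cyclic_points.
Qed.

Lemma good_blocks B : B \in blocks -> good_block B.
Proof. by case/and5P: check => _ _ _ /allP H _ /H. Qed.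

Lemma block_points B p : B \in blocks -> p \in B -> p \in cyclic_points.
Proof.
by move=> /good_blocks /and4P[_ _ /allP H _] /H; rewrite mem_cyclic_points.
Qed.

Lemma block_ordinary B p q : B \in blocks -> p \in B -> q \in B -> p != q ->
  (p.1 < r) || (q.1 < r).
Proof.
move=> /good_blocks /and4P[_ uniqB _ count1] pB qB npq.
rewrite -[_ || _]negbK negb_or -!leqNgt; apply: contraL count1 => /andP[rp rq].
rewrite -ltnNge -size_filter; apply: (@leq_trans (size [:: p; q])) => //.
apply: uniq_leq_size; first by rewrite /= inE andbT.
by move=> x; rewrite !inE mem_filter => /orP[/eqP->|/eqP->]; rewrite ?rp ?rq.
Qed.

Lemma block_differencesP o B d :
  reflect (exists p q, [/\ p \in B, q \in B, q != p, p.1 = o & d = shift (v - p.2) q])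
          (d \in block_differences o B).
Proof.
apply: (iffP flatten_mapP) => [[p]|[p [q [pB qB nqp po ->]]]].
  rewrite mem_filter => /andP[/eqP po pB] /mapP[q].
  by rewrite mem_filter => /andP[nqp qB] ->; exists p, q.
exists p; first by rewrite mem_filter po eqxx.
by apply/mapP; exists q => //; rewrite mem_filter nqp.
Qed.

Lemma differencesP o d :
  reflect (exists B p q, [/\ B \in blocks, p \in B, q \in B, q != p &
             p.1 = o /\ d = shift (v - p.2) q])
          (d \in differences o).
Proof.
apply: (iffP flatten_mapP) =>
  [[B HB /block_differencesP [p [q []]]]|[B [p [q [HB pB qB nqp [po dE]]]]]].
  by exists B, p, q.
by exists B => //; apply/block_differencesP; exists p, q.
Qed.

Lemma point_lt p : p \in cyclic_points -> p.2 < orbit_len p.1.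
Proof. by rewrite mem_cyclic_points => /andP[]. Qed.

Lemma ordinary_lt p : p \in cyclic_points -> p.1 < r -> p.2 < v.
Proof. by move=> /point_lt + lt_p; rewrite /orbit_len lt_p. Qed.

Lemma block_cross B p q : B \in blocks -> p \in B -> q \in B -> p != q ->
  cyclic_label p != cyclic_label q.
Proof.
move=> HB; wlog lt_p : p q / p.1 < r => [H pB qB npq|pB qB npq].
  have /orP[lt_p|lt_q] := block_ordinary HB pB qB npq; first exact: H.
  by rewrite eq_sym; apply: H; rewrite // eq_sym.
have dD : shift (v - p.2) q \in differences p.1.
  by apply/differencesP; exists B, p, q; rewrite eq_sym.
move: dD; rewrite mem_differences // => /andP[_].
have lt_pv := ordinary_lt (block_points HB pB) lt_p.
have <- : shift (v - p.2) p = (p.1, 0).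
  by rewrite /shift subnKC ?(ltnW lt_pv) // /orbit_len lt_p modnn.
by rewrite eq_label_shift eq_sym.
Qed.

Lemma cover_ordinary x y : x \in cyclic_points -> y \in cyclic_points -> x.1 < r ->
  cyclic_label x != cyclic_label y ->
  exists B k p q, [/\ B \in blocks, p \in B, q \in B, shift k p = x & shift k q = y].
Proof.
move=> xV yV lt_x nxy; have lt_xv := ordinary_lt xV lt_x.
have x0 : shift (v - x.2) x = (x.1, 0).
  by rewrite /shift subnKC ?(ltnW lt_xv) // /orbit_len lt_x modnn.
have : shift (v - x.2) y \in differences x.1.
  by rewrite mem_differences // shift_points // -x0 eq_label_shift eq_sym.
case/differencesP=> B [p [q [HB pB qB nqp [po dE]]]].
have lt_p : p.1 < r by rewrite po.
have lt_pv := ordinary_lt (block_points HB pB) lt_p.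
(* Move [p] to 0, then 0 to [x.2]. *)
exists B, (v - p.2 + x.2), p, q; split=> //.
- rewrite /shift addnA subnKC ?(ltnW lt_pv) // po /orbit_len lt_x modnDl modn_small //.
  by rewrite -surjective_pairing.
- rewrite -shift_shift -dE shift_shift subnK ?(ltnW lt_xv) //.
  by rewrite shift_multiple // point_lt.
Qed.

(** The difference from the first point of the pair to the second is invariant under translation, so
    both base blocks produce the same one. It occurs only once, hence the blocks agree, then the
    points taken as origin, then the translations. In particular no base block is fixed by a nonzero
    translation. *)
Lemma unique_ordinary B B' k k' p q p' q' :
  B < size blocks -> B' < size blocks -> k < v -> k' < v ->
  p \in nth [::] blocks B -> q \in nth [::] blocks B ->
  p' \in nth [::] blocks B' -> q' \in nth [::] blocks B' ->
  p.1 < r -> p != q -> shift k p = shift k' p' -> shift k q = shift k' q' ->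
  B = B' /\ k = k'.
Proof.
move=> ltB ltB' ltk ltk' pB qB pB' qB' lt_p npq Ep Eq.
have HB := mem_nth [::] ltB; have HB' := mem_nth [::] ltB'.
have po : p.1 = p'.1 by case: Ep.
have lt_p' : p'.1 < r by rewrite -po.
have lt_pv := ordinary_lt (block_points HB pB) lt_p.
have lt_pv' := ordinary_lt (block_points HB' pB') lt_p'.
have npq' : p' != q'.
  apply: contraNneq npq => E; apply/eqP.
  have : shift k p = shift k q by rewrite Ep Eq E.
  move/(congr1 (shift (v - k))); rewrite !shift_shift subnKC ?(ltnW ltk) //.
  by rewrite !shift_multiple ?point_lt // (block_points HB).
have Emod : p.2 + k = p'.2 + k' %[mod v].
  by case: Ep => _; rewrite /orbit_len lt_p lt_p'.
pose d := shift (v - p.2) q.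
have dE : d = shift (v - p'.2) q'.
  (* Subtracting [c] amounts to translating by [s] and subtracting c + s; the summand v + v keeps
     the subtraction in nat exact. *)
  have H c s z : c < v -> s < v -> shift (v - c) z = shift (v + v - (c + s)) (shift s z).
    move=> lt_c lt_s; rewrite shift_shift.
    have -> : s + (v + v - (c + s)) = v - c + v.
      by rewrite addnBA ?leq_add ?(ltnW lt_c) ?(ltnW lt_s) // addnC subnDr addnBAC ?(ltnW lt_c).
    by rewrite -[RHS]shift_mod modnDr shift_mod.
  rewrite /d (H _ k) // (H _ k' q') // Eq -[LHS]shift_mod -[RHS]shift_mod; congr shift.
  apply/eqP; rewrite -(eqn_modDr (p.2 + k)) subnK ?leq_add ?(ltnW lt_pv) ?(ltnW ltk) //.
  by rewrite -[X in _ == X]modnDmr Emod modnDmr subnK ?leq_add ?(ltnW lt_pv') ?(ltnW ltk').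
have dB : d \in block_differences p.1 (nth [::] blocks B).
  by apply/block_differencesP; exists p, q; rewrite eq_sym.
have dB' : d \in block_differences p.1 (nth [::] blocks B').
  by apply/block_differencesP; exists p', q'; rewrite eq_sym.
have uD := uniq_differences lt_p.
have BB : B = B'.
  apply: (uniq_flatten_nth uD); rewrite ?size_map // (nth_map [::]) //; [exact: dB | exact: dB'].
subst B'.
have uB : uniq (block_differences p.1 (nth [::] blocks B)).
  by apply: uniq_flatten_mem uD _; apply: map_f.
set F := [seq z <- nth [::] blocks B | z.1 == p.1].
have pF : p \in F by rewrite mem_filter eqxx.
have pF' : p' \in F by rewrite mem_filter po eqxx.
(* Locates [d] in the sublist belonging to the origin [z], so that absence of repetition identifies
   the origin. *)
have ind z : z \in F -> forall w, w \in nth [::] blocks B -> w != z -> d = shift (v - z.2) w ->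
    d \in nth [::] [seq [seq shift (v - s.2) t | t <- nth [::] blocks B & t != s] | s <- F] (index z F).
  move=> zF w wB nwz ->; rewrite (nth_map z) ?index_mem // nth_index //.
  by apply/mapP; exists w => //; rewrite mem_filter nwz.
have Ei : index p F = index p' F.
  apply: (uniq_flatten_nth uB); rewrite ?size_map ?index_mem //.
  - by apply: (ind _ pF q) => //; rewrite eq_sym.
  - by apply: (ind _ pF' q') => //; rewrite eq_sym.
have pp : p = p' by apply: (index_inj p pF pF').
split=> //; move: Emod; rewrite -pp => /eqP; rewrite eqn_modDl => /eqP.
by rewrite !modn_small.
Qed.

Lemma count_seq_sub (T : choiceType) (s : seq T) (P : pred T) : uniq s ->
  #|[pred x : seq_sub s | P (val x)]| = count P s.
Proof.
move=> us; have perm_s : perm_eq (map val (enum {: seq_sub s})) s.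
  apply: uniq_perm => //; first by rewrite (map_inj_uniq val_inj) enum_uniq.
  move=> x; apply/mapP/idP => [[y _ ->]|xs]; first exact: valP.
  by exists (SeqSub xs); rewrite ?mem_enum.
rewrite -(permP perm_s) count_map -sum1_count big_enum_cond /= sum1dep_card.
by apply: eq_card => x; rewrite !inE.
Qed.

(** The blocks are the translates of the base blocks by 0, ..., v-1. Two points of the exceptional
    group are never adjacent, so each edge has an ordinary end, from which the differences can be
    read. *)
Lemma k4dec_cyclic :
  k4dec (multipartite (fun p : seq_sub cyclic_points => cyclic_label (val p))).
Proof.
pose J : finType := ('I_(size blocks) * 'I_v)%type.
pose bl (j : J) := nth [::] blocks j.1.
have HB (j : J) : bl j \in blocks by rewrite mem_nth.
have size_b (j : J) : size (bl j) = 4 by case/and4P: (good_blocks (HB j)) => /eqP.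
have [e He] : exists e : J -> 'I_4 -> seq_sub cyclic_points,
    forall j k, val (e j k) = shift j.2 (nth (0, 0) (bl j) k).
  have step (j : J) : exists e : 'I_4 -> seq_sub cyclic_points,
      forall k, val (e k) = shift j.2 (nth (0, 0) (bl j) k).
    have /fin_all_exists [e He] : forall k : 'I_4, exists x : seq_sub cyclic_points,
        val x = shift j.2 (nth (0, 0) (bl j) k).
      move=> k; have pV : shift j.2 (nth (0, 0) (bl j) k) \in cyclic_points.
        by apply: shift_points; apply: block_points (HB j) _; rewrite mem_nth ?size_b.
      by exists (SeqSub pV).
    by exists e.
  by have [e He] := fin_all_exists step; exists e.
have nth_b (j : J) (k : 'I_4) : nth (0, 0) (bl j) k \in bl j by rewrite mem_nth ?size_b.
have nth_inj (j : J) (k k' : 'I_4) : k != k' -> nth (0, 0) (bl j) k != nth (0, 0) (bl j) k'.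
  by move=> nk; rewrite nth_uniq ?size_b //; case/and4P: (good_blocks (HB j)).
have sound (j : J) k k' : k != k' -> cyclic_label (val (e j k)) != cyclic_label (val (e j k')).
  by move=> nk; rewrite !He eq_label_shift; apply: block_cross (HB j) _ _ (nth_inj _ _ _ nk).
have ex_nth (j : J) p : p \in bl j -> exists k : 'I_4, nth (0, 0) (bl j) k = p.
  move=> pB; have lt_i : index p (bl j) < 4 by rewrite -(size_b j) index_mem.
  by exists (Ordinal lt_i); rewrite nth_index.
exists J, e; split=> //.
- move=> j k k' E; apply/eqP; apply: contraT => nk.
  by have := sound j _ _ nk; rewrite E eqxx.
- have half (x y : seq_sub cyclic_points) : (val x).1 < r ->
      cyclic_label (val x) != cyclic_label (val y) ->
      exists j k k', e j k = x /\ e j k' = y.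
    move=> lt_x nxy.
    have [B [s [p [q [BB pB qB Ep Eq]]]]] := cover_ordinary (valP x) (valP y) lt_x nxy.
    have lt_B : index B blocks < size blocks by rewrite index_mem.
    have lt_s : s %% v < v by rewrite ltn_pmod.
    pose j : J := (Ordinal lt_B, Ordinal lt_s).
    have blj : bl j = B by rewrite /bl /= nth_index.
    have [k Ek] : exists k : 'I_4, nth (0, 0) (bl j) k = p by apply: ex_nth; rewrite blj.
    have [k' Ek'] : exists k : 'I_4, nth (0, 0) (bl j) k = q by apply: ex_nth; rewrite blj.
    by exists j, k, k'; split; apply: val_inj; rewrite He ?Ek ?Ek' /= shift_mod.
  move=> x y _; rewrite /multipartite => nxy.
  have [lt_x|ge_x] := ltnP (val x).1 r; first exact: half.
  have [lt_y|ge_y] := ltnP (val y).1 r.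
    by rewrite eq_sym in nxy; have [j [k [k' []]]] := half _ _ lt_y nxy; exists j, k', k.
  by move: nxy; rewrite /cyclic_label !ltnNge ge_x ge_y.
- move=> j j' k k' l l' nk /(congr1 val) + /(congr1 val); rewrite !He => E1 E2.
  have [H1 H2] : val j.1 = val j'.1 /\ val j.2 = val j'.2.
    have /orP[lt_p|lt_p] := block_ordinary (HB j) (nth_b j k) (nth_b j k') (nth_inj j _ _ nk).
    + exact: (unique_ordinary _ _ _ _ (nth_b j k) (nth_b j k') (nth_b j' l) (nth_b j' l')
                lt_p (nth_inj j _ _ nk) E1 E2).
    + have nk' : k' != k by rewrite eq_sym.
      exact: (unique_ordinary _ _ _ _ (nth_b j k') (nth_b j k) (nth_b j' l') (nth_b j' l)
                lt_p (nth_inj j _ _ nk') E2 E1).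
  by case: j j' H1 H2 {E1 E2} => [B s] [B' s'] /= /val_inj -> /val_inj ->.
Qed.

Lemma gdd_cyclic (g u m : nat) : profile_check g u m -> gdd g u m.
Proof.
move=> /and3P[/allP le_u /allP cls_g /eqP cls_m].
pose V := seq_sub cyclic_points; have uV := uniq_cyclic_points.
pose c (p : V) : option 'I_u := if cyclic_label (val p) is l.+1 then insub l else None.
have cS (p : V) (l : 'I_u) : (c p == Some l) = (cyclic_label (val p) == l.+1).
  rewrite /c; case: (cyclic_label (val p)) (le_u _ (valP p)) => // n lt_n.
  by rewrite insubT eqSS (inj_eq Some_inj) -(inj_eq val_inj).
have c0 (p : V) : (c p == None) = (cyclic_label (val p) == 0).
  rewrite /c; case: (cyclic_label (val p)) (le_u _ (valP p)) => // n lt_n.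
  by rewrite insubT.
apply/(@gddP V 'I_u c); first exact: card_ord.
- move=> l; rewrite -[RHS](eqP (cls_g l.+1 _)); last by rewrite mem_iota /= add1n ltnS.
  by rewrite -(count_seq_sub _ uV); apply: eq_card => p; rewrite !inE cS.
- by rewrite -cls_m -(count_seq_sub _ uV); apply: eq_card => p; rewrite !inE c0.
apply: k4dec_bij (@inj_id _) (leqnn _) _ k4dec_cyclic => x y.
rewrite /multipartite; congr negb; have := cS y; have := c0 y.
case: (c y) => [l|] H0 HS; first by rewrite cS; have := HS l; rewrite eqxx => /esym/eqP ->.
by rewrite c0; move: H0; rewrite eqxx => /esym/eqP ->.
Qed.
End CyclicDesign.

(** [(v, r, a, b, lens, codes)], where [codes] lists the base blocks four entries at a
time, the point [(o, x)] being coded by [o * v + x]. *)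
Definition cyclic_design : Type := nat * nat * nat * nat * seq nat * seq nat.

Fixpoint decode_blocks (v : nat) (s : seq nat) : seq (seq (nat * nat)) :=
  if s is [:: c0, c1, c2, c3 & s'] then
    [seq (c %/ v, c %% v) | c <- [:: c0; c1; c2; c3]] :: decode_blocks v s'
  else [::].

Definition design_check (g u m : nat) (D : cyclic_design) : bool :=
  let: (v, r, a, b, lens, codes) := D in
  difference_check v r a b lens (decode_blocks v codes) &&
  profile_check v r a b lens g u m.

(** Entry number i is the design for m + 3i, so a table runs through a residue class modulo 3
    without gaps. *)
Definition table_check (g u m : nat) (Ds : seq cyclic_design) : bool :=
  all (fun iD => design_check g u (m + 3 * iD.1) iD.2) (zip (iota 0 (size Ds)) Ds).

Lemma gdd_table (g u m i : nat) (Ds : seq cyclic_design) :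
  table_check g u m Ds -> i < size Ds -> gdd g u (m + 3 * i).
Proof.
move=> /allP check lt_i; pose D0 : cyclic_design := (0, 0, 0, 0, [::], [::]).
have size_zip : size (zip (iota 0 (size Ds)) Ds) = size Ds by rewrite size_zip size_iota minnn.
have := check (nth (0, D0) (zip (iota 0 (size Ds)) Ds) i); rewrite mem_nth ?size_zip // => /(_ isT).
rewrite nth_zip ?size_iota // nth_iota // add0n /=.
case: (nth D0 Ds i) => [[[[[v r] a] b] lens] codes] /andP[chk prof].
exact (gdd_cyclic chk prof).
Qed.

(** * Explicit designs *)

(** The range m <= 3(u-1) for type 6^u m^1 takes u entries, the range m <= 6(u-1) for 12^u m^1 takes
    2u-1. *)
Definition designs_6_5 : seq cyclic_design := [::
   (5, 6, 6, 5, [::],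
     [:: 0; 1; 18; 29; 0; 2; 14; 21; 0; 6; 22; 23; 0; 7; 11; 13; 0; 8; 16; 19; 0; 9; 26;
     27; 5; 6; 13; 24; 5; 7; 19; 26; 10; 11; 19; 28; 10; 16; 17; 24; 10; 23; 26; 29; 15;
     21; 24; 28]);
   (5, 6, 6, 5, [:: 1; 1; 1],
     [:: 0; 1; 12; 23; 0; 2; 18; 26; 0; 6; 8; 17; 0; 7; 14; 35; 0; 9; 13; 30; 0; 19; 28;
     40; 0; 21; 24; 27; 5; 6; 27; 29; 5; 11; 23; 40; 5; 13; 21; 22; 5; 17; 18; 24; 10;
     11; 17; 19; 10; 12; 28; 29; 15; 23; 27; 30; 15; 24; 26; 35]);
   (5, 6, 6, 5, [:: 5; 1],
     [:: 0; 1; 28; 32; 0; 2; 13; 30; 0; 6; 19; 34; 0; 7; 8; 14; 0; 9; 16; 18; 0; 12; 23;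
     35; 0; 17; 21; 29; 0; 22; 24; 26; 5; 7; 21; 32; 5; 13; 29; 34; 5; 14; 26; 28; 5; 16;
     27; 35; 5; 22; 23; 31; 10; 11; 18; 24; 10; 12; 16; 30; 10; 22; 28; 34; 15; 16; 23;
     33; 15; 28; 29; 31]);
   (5, 6, 6, 5, [:: 5; 1; 1; 1; 1],
     [:: 0; 1; 13; 33; 0; 2; 18; 19; 0; 6; 9; 30; 0; 7; 24; 45; 0; 8; 21; 50; 0; 11; 28;
     34; 0; 14; 27; 31; 0; 22; 26; 35; 0; 23; 29; 40; 5; 6; 27; 29; 5; 11; 14; 30; 5; 12;
     18; 35; 5; 13; 17; 40; 5; 16; 24; 33; 5; 19; 21; 32; 10; 11; 22; 24; 10; 17; 26; 45;
     10; 18; 29; 50; 15; 17; 21; 31; 15; 27; 28; 30; 20; 21; 28; 33]);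
   (5, 6, 6, 5, [:: 5; 5; 1; 1],
     [:: 0; 1; 14; 35; 0; 2; 9; 30; 0; 6; 8; 37; 0; 11; 27; 40; 0; 12; 16; 31; 0; 17; 28;
     34; 0; 18; 21; 38; 0; 19; 26; 45; 0; 22; 29; 36; 0; 23; 24; 32; 5; 6; 12; 33; 5; 13;
     24; 35; 5; 14; 22; 45; 5; 16; 18; 34; 5; 17; 23; 38; 5; 19; 21; 40; 5; 26; 29; 37;
     5; 27; 28; 30; 10; 11; 29; 39; 10; 12; 24; 30; 10; 16; 17; 35; 10; 18; 27; 32; 15;
     24; 28; 37; 20; 22; 28; 32])].

Definition designs_6_7 : seq cyclic_design := [::
   (14, 3, 3, 7, [::],
     [:: 0; 1; 31; 33; 0; 2; 19; 24; 0; 3; 29; 39; 0; 4; 38; 41; 0; 5; 16; 18; 0; 6; 15;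
     26; 14; 15; 31; 37; 14; 18; 29; 38; 14; 20; 32; 33]);
   (7, 6, 6, 7, [:: 1; 1; 1],
     [:: 0; 1; 9; 38; 0; 2; 24; 36; 0; 3; 30; 32; 0; 10; 18; 42; 0; 11; 20; 33; 0; 12;
     27; 56; 0; 13; 25; 40; 0; 15; 17; 26; 0; 16; 19; 39; 0; 23; 31; 49; 7; 8; 10; 33; 7;
     17; 25; 27; 7; 18; 23; 24; 7; 19; 31; 34; 7; 20; 39; 49; 7; 37; 38; 40; 14; 15; 31;
     39; 14; 32; 36; 56; 21; 24; 34; 37; 21; 30; 39; 42; 21; 32; 33; 38]);
   (14, 3, 3, 7, [:: 2; 2; 1; 1],
     [:: 0; 1; 19; 32; 0; 2; 6; 39; 0; 3; 25; 27; 0; 5; 20; 42; 0; 16; 38; 70; 0; 17; 29;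
     84; 0; 23; 26; 57; 0; 30; 41; 56; 0; 34; 36; 40; 14; 15; 19; 34; 14; 20; 37; 38; 14;
     30; 39; 43]);
   (7, 6, 6, 7, nseq 9 1,
     [:: 0; 1; 5; 24; 0; 8; 17; 98; 0; 9; 27; 40; 0; 10; 16; 91; 0; 11; 36; 63; 0; 12;
     25; 70; 0; 13; 18; 42; 0; 15; 38; 84; 0; 19; 30; 56; 0; 20; 33; 37; 0; 22; 41; 77;
     0; 29; 31; 32; 0; 34; 39; 49; 7; 8; 12; 32; 7; 15; 23; 49; 7; 17; 29; 77; 7; 18; 24;
     33; 7; 22; 40; 56; 7; 26; 30; 84; 7; 36; 37; 41; 14; 15; 19; 41; 14; 23; 25; 26; 14;
     24; 30; 63; 14; 31; 39; 70; 21; 29; 38; 91; 21; 31; 37; 42; 21; 33; 36; 98]);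
   (7, 6, 6, 7, [:: 7; 1; 1; 1; 1; 1],
     [:: 0; 1; 3; 43; 0; 8; 39; 56; 0; 9; 32; 41; 0; 10; 16; 46; 0; 11; 19; 49; 0; 12;
     15; 77; 0; 13; 36; 40; 0; 17; 33; 70; 0; 18; 29; 31; 0; 20; 22; 30; 0; 23; 25; 48;
     0; 24; 27; 44; 0; 26; 38; 45; 0; 34; 37; 63; 7; 8; 10; 45; 7; 16; 22; 63; 7; 18; 26;
     36; 7; 19; 23; 24; 7; 25; 40; 70; 7; 27; 31; 48; 7; 29; 32; 47; 7; 33; 34; 46; 14;
     15; 17; 42; 14; 24; 29; 56; 14; 33; 41; 47; 14; 36; 37; 45; 14; 38; 40; 43; 21; 30;
     41; 77; 21; 31; 37; 49; 21; 34; 39; 43]);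
   (7, 6, 6, 7, [:: 1; 1; 1; 1; 1; 1; 1; 7; 1],
     [:: 0; 1; 24; 26; 0; 2; 22; 91; 0; 3; 39; 97; 0; 8; 38; 49; 0; 9; 17; 95; 0; 10; 15;
     63; 0; 11; 20; 92; 0; 12; 18; 98; 0; 13; 40; 77; 0; 16; 33; 70; 0; 19; 32; 42; 0;
     29; 31; 93; 0; 30; 41; 84; 0; 34; 37; 56; 7; 8; 32; 91; 7; 9; 25; 96; 7; 10; 29; 30;
     7; 17; 27; 84; 7; 18; 26; 56; 7; 22; 38; 42; 7; 24; 36; 70; 7; 39; 40; 92; 14; 15;
     30; 97; 14; 16; 38; 41; 14; 17; 40; 94; 14; 23; 27; 95; 14; 25; 33; 77; 14; 26; 32;
     49; 21; 22; 39; 95; 21; 30; 33; 91; 21; 31; 36; 98; 21; 32; 41; 63; 28; 36; 41; 91]);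
   (7, 6, 6, 7, [:: 7; 7; 1; 1; 1; 1],
     [:: 0; 1; 25; 48; 0; 2; 20; 50; 0; 3; 30; 45; 0; 8; 12; 49; 0; 9; 36; 63; 0; 10; 15;
     56; 0; 11; 22; 77; 0; 13; 39; 51; 0; 16; 41; 44; 0; 17; 40; 70; 0; 19; 27; 46; 0;
     23; 31; 43; 0; 26; 32; 52; 0; 29; 33; 54; 0; 37; 38; 53; 7; 8; 34; 50; 7; 9; 20; 42;
     7; 15; 27; 54; 7; 16; 36; 48; 7; 17; 26; 43; 7; 22; 38; 44; 7; 23; 32; 70; 7; 24;
     37; 45; 7; 29; 30; 46; 7; 31; 39; 53; 14; 15; 19; 50; 14; 24; 34; 63; 14; 25; 36;
     54; 14; 27; 32; 45; 14; 29; 31; 55; 14; 30; 40; 44; 14; 33; 38; 77; 21; 22; 24; 52;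
     21; 32; 38; 56; 21; 36; 40; 53; 28; 37; 39; 46])].

Definition designs_6_9 : seq cyclic_design := [::
   (18, 3, 3, 9, [::],
     [:: 0; 1; 8; 42; 0; 2; 23; 26; 0; 3; 49; 51; 0; 4; 19; 44; 0; 5; 22; 34; 0; 6; 38;
     43; 0; 20; 30; 31; 0; 25; 39; 53; 0; 28; 32; 47; 18; 20; 41; 44; 18; 23; 40; 52; 18;
     38; 48; 49]);
   (9, 6, 6, 9, [:: 3],
     [:: 0; 1; 31; 33; 0; 2; 10; 55; 0; 3; 46; 47; 0; 4; 19; 21; 0; 11; 22; 39; 0; 12;
     20; 35; 0; 13; 43; 48; 0; 14; 38; 51; 0; 15; 25; 28; 0; 16; 23; 42; 0; 29; 44; 50;
     0; 34; 37; 49; 0; 40; 41; 54; 9; 10; 23; 56; 9; 11; 40; 43; 9; 12; 50; 52; 9; 13;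
     33; 34; 9; 21; 28; 51; 9; 24; 35; 48; 18; 19; 32; 56; 18; 21; 41; 43; 18; 22; 50;
     53; 18; 28; 39; 47; 18; 35; 42; 52; 27; 30; 40; 44; 27; 31; 47; 56; 36; 47; 52; 54]);
   (9, 6, 6, 9, [:: 3; 1; 1; 1],
     [:: 0; 1; 16; 38; 0; 2; 25; 50; 0; 3; 35; 46; 0; 4; 17; 56; 0; 10; 22; 54; 0; 11;
     40; 72; 0; 12; 20; 53; 0; 14; 29; 81; 0; 19; 24; 44; 0; 21; 31; 63; 0; 26; 33; 49;
     0; 28; 39; 41; 0; 30; 34; 42; 0; 43; 47; 51; 9; 10; 29; 44; 9; 11; 15; 48; 9; 19;
     25; 30; 9; 20; 37; 49; 9; 22; 23; 35; 9; 24; 52; 55; 9; 31; 32; 34; 9; 39; 42; 53;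
     9; 41; 47; 63; 18; 20; 41; 42; 18; 33; 48; 72; 18; 35; 49; 54; 18; 37; 53; 81; 27;
     37; 41; 56; 27; 43; 53; 54; 27; 46; 48; 49]);
   (27, 2, 2, 9, [:: 3; 3; 3],
     [:: 0; 1; 8; 108; 0; 2; 14; 43; 0; 3; 28; 40; 0; 4; 21; 42; 0; 5; 39; 82; 0; 11; 46;
     54; 0; 30; 47; 50; 0; 31; 44; 56; 0; 32; 51; 53; 0; 33; 49; 81; 27; 28; 32; 108]);
   (9, 6, 6, 9, [:: 3; 3; 3; 1; 1; 1],
     [:: 0; 1; 23; 54; 0; 2; 21; 73; 0; 3; 50; 52; 0; 4; 24; 46; 0; 10; 12; 34; 0; 11;
     16; 64; 0; 13; 37; 44; 0; 14; 15; 55; 0; 17; 43; 81; 0; 25; 29; 99; 0; 26; 28; 33;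
     0; 30; 53; 63; 0; 31; 39; 65; 0; 32; 42; 90; 0; 35; 38; 41; 0; 40; 48; 72; 9; 12;
     28; 29; 9; 19; 26; 73; 9; 20; 24; 64; 9; 21; 22; 37; 9; 23; 46; 90; 9; 25; 49; 50;
     9; 30; 52; 54; 9; 32; 39; 72; 9; 38; 51; 99; 9; 41; 47; 53; 9; 43; 48; 74; 18; 21;
     40; 44; 18; 28; 39; 63; 18; 30; 46; 56; 18; 32; 35; 47; 18; 33; 53; 81; 18; 38; 48;
     54; 27; 29; 46; 74; 27; 40; 41; 55; 36; 47; 52; 64]);
   (9, 6, 6, 9, [:: 3; 3; 3; 3; 3],
     [:: 0; 1; 29; 73; 0; 2; 35; 90; 0; 3; 15; 22; 0; 4; 43; 63; 0; 10; 21; 24; 0; 11;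
     17; 23; 0; 13; 34; 46; 0; 14; 49; 82; 0; 16; 30; 64; 0; 20; 42; 48; 0; 25; 41; 83;
     0; 26; 47; 54; 0; 31; 50; 55; 0; 32; 52; 74; 0; 37; 38; 81; 0; 40; 53; 56; 0; 44;
     51; 92; 9; 10; 49; 72; 9; 11; 43; 54; 9; 13; 42; 91; 9; 19; 34; 40; 9; 22; 39; 73;
     9; 26; 28; 82; 9; 29; 46; 65; 9; 31; 44; 56; 9; 33; 47; 92; 9; 35; 37; 64; 9; 50;
     52; 81; 18; 19; 51; 91; 18; 20; 30; 56; 18; 22; 53; 64; 18; 31; 35; 81; 18; 32; 42;
     92; 18; 34; 41; 74; 18; 37; 47; 65; 18; 38; 52; 73; 27; 28; 30; 52; 27; 39; 41; 44;
     36; 47; 48; 53]);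
   (18, 3, 3, 9, [:: 9; 9],
     [:: 0; 1; 25; 55; 0; 2; 14; 75; 0; 3; 10; 41; 0; 5; 44; 61; 0; 19; 51; 78; 0; 20;
     50; 76; 0; 21; 40; 72; 0; 22; 42; 80; 0; 23; 31; 34; 0; 26; 37; 59; 0; 28; 33; 62;
     0; 29; 46; 60; 0; 30; 52; 74; 0; 32; 53; 77; 0; 35; 43; 58; 0; 47; 48; 57; 18; 19;
     43; 55; 18; 20; 32; 75; 18; 41; 49; 52; 18; 46; 51; 62; 36; 38; 50; 75]);
   (9, 6, 6, 9, [:: 3; 3; 3; 9; 1; 1; 1],
     [:: 0; 1; 21; 82; 0; 2; 50; 85; 0; 3; 43; 46; 0; 4; 23; 54; 0; 10; 44; 87; 0; 11;
     35; 63; 0; 12; 53; 74; 0; 13; 17; 64; 0; 14; 38; 99; 0; 15; 16; 88; 0; 22; 33; 90;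
     0; 24; 41; 65; 0; 25; 51; 55; 0; 26; 34; 86; 0; 28; 42; 84; 0; 29; 37; 108; 0; 30;
     31; 73; 0; 32; 39; 89; 0; 47; 49; 72; 9; 11; 32; 85; 9; 12; 28; 52; 9; 19; 53; 87;
     9; 20; 44; 72; 9; 21; 35; 56; 9; 22; 26; 73; 9; 23; 47; 108; 9; 24; 25; 88; 9; 29;
     31; 54; 9; 37; 51; 84; 9; 38; 46; 90; 9; 39; 40; 55; 9; 41; 48; 89; 18; 20; 41; 85;
     18; 21; 34; 37; 18; 28; 47; 99; 18; 30; 50; 89; 18; 33; 46; 84; 18; 38; 40; 63; 18;
     48; 49; 64; 27; 30; 40; 85; 27; 31; 52; 63; 27; 38; 42; 74; 27; 50; 53; 81; 36; 39;
     49; 85; 36; 47; 51; 56]);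
   (18, 3, 3, 9, [:: 18; 2; 2; 2],
     [:: 0; 1; 39; 73; 0; 2; 23; 71; 0; 3; 29; 108; 0; 4; 41; 64; 0; 5; 24; 63; 0; 6; 28;
     62; 0; 7; 32; 68; 0; 8; 42; 55; 0; 20; 30; 67; 0; 31; 35; 59; 0; 33; 34; 90; 0; 40;
     47; 54; 0; 43; 46; 91; 0; 44; 50; 70; 0; 48; 53; 57; 0; 49; 51; 66; 18; 20; 41; 71;
     18; 21; 47; 72; 18; 23; 42; 63; 18; 24; 46; 62; 18; 25; 50; 68; 18; 38; 48; 67; 18;
     49; 53; 59; 18; 51; 52; 108])].

Definition designs_12_5 : seq cyclic_design := [::
   (20, 3, 3, 5, [::],
     [:: 0; 1; 13; 32; 0; 2; 23; 36; 0; 3; 14; 42; 0; 4; 57; 58; 0; 22; 28; 56; 0; 24;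
     47; 51; 0; 26; 27; 38; 0; 29; 33; 46; 0; 37; 43; 49; 0; 41; 44; 52; 20; 22; 44; 51;
     20; 23; 41; 59]);
   (30, 2, 2, 5, [:: 3],
     [:: 0; 1; 39; 53; 0; 2; 24; 36; 0; 3; 17; 44; 0; 4; 51; 62; 0; 7; 18; 31; 0; 9; 46;
     58; 0; 32; 33; 60; 0; 48; 56; 59; 30; 32; 36; 53]);
   (20, 3, 3, 5, [:: 2; 2; 2],
     [:: 0; 1; 8; 29; 0; 2; 33; 39; 0; 3; 56; 81; 0; 4; 22; 48; 0; 6; 47; 49; 0; 9; 23;
     61; 0; 24; 27; 101; 0; 26; 42; 58; 0; 32; 36; 54; 0; 46; 57; 100; 0; 51; 52; 59; 20;
     21; 28; 49; 20; 22; 53; 59; 20; 29; 43; 81; 20; 44; 47; 61]);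
   (30, 2, 2, 5, [:: 6; 3],
     [:: 0; 1; 9; 65; 0; 2; 44; 92; 0; 3; 31; 57; 0; 4; 16; 38; 0; 6; 23; 39; 0; 11; 43;
     60; 0; 36; 47; 53; 0; 37; 49; 51; 0; 41; 48; 91; 0; 56; 59; 63; 30; 31; 39; 63]);
   (60, 1, 1, 5, [:: 3; 6; 3],
     [:: 0; 1; 8; 60; 0; 2; 6; 18; 0; 3; 24; 37; 0; 9; 38; 120; 0; 11; 28; 180; 0; 14;
     41; 121]);
   (30, 2, 2, 5, [:: 15],
     [:: 0; 1; 14; 61; 0; 2; 9; 73; 0; 3; 56; 68; 0; 4; 52; 58; 0; 6; 44; 69; 0; 8; 41;
     42; 0; 11; 43; 57; 0; 12; 49; 67; 0; 31; 59; 72; 0; 36; 39; 74; 0; 47; 51; 66; 30;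
     37; 48; 69; 30; 38; 51; 67]);
   (30, 2, 2, 5, [:: 15; 3],
     [:: 0; 1; 18; 49; 0; 2; 24; 68; 0; 3; 37; 73; 0; 4; 42; 71; 0; 7; 16; 61; 0; 11; 32;
     92; 0; 33; 56; 59; 0; 36; 47; 91; 0; 39; 41; 72; 0; 43; 57; 65; 0; 44; 53; 64; 0;
     46; 54; 63; 0; 52; 58; 62; 30; 31; 43; 73]);
   (30, 2, 2, 5, [:: 3; 3; 15],
     [:: 0; 1; 33; 60; 0; 2; 6; 128; 0; 3; 12; 124; 0; 7; 44; 53; 0; 8; 57; 91; 0; 11;
     47; 131; 0; 13; 52; 132; 0; 14; 48; 129; 0; 31; 42; 125; 0; 38; 41; 123; 0; 43; 56;
     133; 0; 51; 59; 61; 0; 54; 58; 90; 30; 31; 54; 132; 30; 32; 48; 121]);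
   (20, 3, 3, 5, [:: 5; 5; 5; 2; 2; 2; 1; 1; 1],
     [:: 0; 1; 8; 83; 0; 2; 39; 64; 0; 3; 59; 161; 0; 4; 27; 103; 0; 6; 34; 61; 0; 9; 38;
     141; 0; 21; 24; 120; 0; 22; 48; 101; 0; 26; 58; 84; 0; 31; 44; 180; 0; 32; 54; 63;
     0; 33; 49; 220; 0; 36; 47; 200; 0; 41; 43; 100; 0; 42; 51; 121; 0; 46; 52; 102; 0;
     53; 57; 81; 20; 21; 28; 103; 20; 22; 59; 84; 20; 24; 47; 63; 20; 26; 54; 81; 20; 29;
     58; 161; 20; 41; 44; 140; 40; 41; 48; 63])].

Definition designs_12_7 : seq cyclic_design := [::
   (14, 6, 6, 7, [::],
     [:: 0; 1; 6; 30; 0; 2; 34; 50; 0; 3; 72; 82; 0; 4; 43; 61; 0; 15; 54; 73; 0; 16; 17;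
     20; 0; 18; 26; 64; 0; 19; 66; 76; 0; 22; 62; 67; 0; 23; 46; 59; 0; 24; 41; 51; 0;
     25; 37; 68; 0; 27; 36; 75; 0; 31; 44; 81; 0; 33; 60; 71; 0; 39; 45; 65; 0; 40; 52;
     55; 0; 47; 69; 74; 0; 58; 78; 80; 14; 16; 67; 83; 14; 19; 48; 50; 14; 29; 58; 75;
     14; 30; 34; 74; 14; 32; 79; 80; 14; 33; 36; 38; 14; 39; 47; 62; 14; 41; 52; 82; 14;
     44; 69; 73; 14; 46; 54; 78; 28; 29; 61; 67; 28; 34; 51; 71; 28; 46; 58; 62; 28; 47;
     64; 73; 42; 43; 47; 66; 42; 73; 78; 81; 56; 57; 68; 83]);
   (21, 4, 4, 7, [:: 3],
     [:: 0; 1; 68; 84; 0; 2; 6; 47; 0; 3; 32; 34; 0; 5; 22; 25; 0; 8; 59; 60; 0; 9; 57;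
     74; 0; 10; 26; 44; 0; 23; 40; 66; 0; 24; 58; 64; 0; 27; 54; 78; 0; 30; 46; 82; 0;
     33; 53; 71; 0; 36; 61; 73; 0; 39; 50; 80; 0; 43; 69; 72; 0; 75; 76; 81; 0; 79; 83;
     85; 21; 22; 67; 75; 21; 26; 36; 65; 21; 29; 52; 86; 21; 30; 47; 78; 21; 43; 45; 51;
     21; 50; 61; 85; 21; 54; 57; 76; 42; 46; 51; 83; 42; 65; 67; 76]);
   (21, 4, 4, 7, [:: 3; 3],
     [:: 0; 1; 31; 33; 0; 2; 52; 55; 0; 3; 29; 37; 0; 4; 44; 107; 0; 5; 64; 67; 0; 6; 71;
     82; 0; 8; 25; 85; 0; 9; 75; 81; 0; 10; 46; 48; 0; 22; 62; 74; 0; 23; 40; 84; 0; 24;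
     60; 68; 0; 27; 51; 78; 0; 36; 54; 69; 0; 39; 45; 79; 0; 41; 43; 73; 0; 47; 58; 105;
     21; 22; 51; 55; 21; 24; 69; 81; 21; 26; 76; 106; 21; 27; 64; 68; 21; 30; 46; 47; 21;
     31; 53; 62; 21; 67; 80; 105; 42; 47; 65; 66; 42; 48; 74; 79; 42; 50; 67; 85; 42; 64;
     83; 84]);
   (14, 6, 6, 7, [:: 2; 7],
     [:: 0; 1; 39; 54; 0; 2; 6; 74; 0; 3; 20; 100; 0; 5; 23; 64; 0; 15; 46; 101; 0; 16;
     34; 84; 0; 19; 58; 80; 0; 22; 27; 65; 0; 24; 61; 81; 0; 25; 79; 102; 0; 26; 60; 78;
     0; 29; 51; 69; 0; 30; 43; 67; 0; 31; 75; 99; 0; 32; 37; 103; 0; 33; 62; 98; 0; 36;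
     52; 68; 0; 40; 41; 45; 0; 44; 48; 71; 0; 47; 50; 55; 0; 57; 73; 76; 0; 66; 83; 85;
     14; 15; 41; 103; 14; 16; 20; 52; 14; 17; 39; 72; 14; 29; 53; 99; 14; 30; 33; 81; 14;
     31; 48; 74; 14; 34; 43; 73; 14; 37; 64; 104; 14; 38; 44; 78; 14; 47; 76; 85; 14; 51;
     60; 68; 14; 54; 55; 79; 14; 58; 59; 61; 28; 30; 34; 64; 28; 53; 61; 66; 28; 54; 59;
     85; 28; 67; 78; 80; 28; 73; 74; 83; 42; 44; 75; 103; 42; 57; 67; 98; 42; 62; 74; 99;
     42; 68; 78; 100; 56; 71; 79; 98]);
   (28, 3, 3, 7, [:: 4; 2; 2; 2; 1; 1],
     [:: 0; 1; 9; 52; 0; 2; 24; 46; 0; 3; 69; 112; 0; 5; 15; 58; 0; 11; 48; 168; 0; 12;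
     41; 67; 0; 30; 39; 141; 0; 31; 65; 84; 0; 32; 76; 196; 0; 33; 53; 78; 0; 34; 45; 47;
     0; 36; 68; 224; 0; 38; 75; 79; 0; 40; 60; 86; 0; 54; 57; 85; 0; 55; 74; 87; 0; 59;
     72; 140; 0; 61; 64; 73; 0; 62; 80; 82; 28; 29; 53; 68; 28; 33; 57; 113; 28; 34; 46;
     64; 28; 61; 66; 83; 28; 78; 79; 169]);
   (42, 2, 2, 7, [:: 3; 3; 3; 6],
     [:: 0; 1; 27; 54; 0; 2; 66; 86; 0; 3; 62; 68; 0; 4; 55; 127; 0; 5; 43; 169; 0; 6;
     18; 29; 0; 8; 17; 214; 0; 10; 44; 46; 0; 20; 50; 67; 0; 45; 74; 75; 0; 48; 58; 85;
     0; 52; 57; 211; 0; 60; 71; 210; 0; 61; 81; 128; 0; 73; 82; 213; 0; 79; 83; 168; 42;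
     45; 60; 68]);
   (28, 3, 3, 7, [:: 7; 7; 1; 1; 1; 1],
     [:: 0; 1; 39; 89; 0; 2; 32; 112; 0; 3; 11; 68; 0; 4; 58; 75; 0; 5; 34; 50; 0; 6; 16;
     67; 0; 9; 83; 115; 0; 13; 72; 84; 0; 31; 36; 55; 0; 33; 41; 43; 0; 37; 48; 90; 0;
     40; 60; 87; 0; 44; 80; 116; 0; 46; 73; 140; 0; 47; 62; 196; 0; 51; 81; 168; 0; 52;
     64; 224; 0; 53; 54; 114; 0; 66; 76; 118; 0; 69; 78; 86; 28; 31; 82; 86; 28; 34; 78;
     118; 28; 41; 66; 74; 28; 57; 80; 87; 28; 59; 60; 75; 28; 62; 65; 113; 28; 67; 69;
     73]);
   (42, 2, 2, 7, [:: 21],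
     [:: 0; 1; 67; 85; 0; 2; 5; 20; 0; 4; 47; 91; 0; 6; 71; 79; 0; 8; 53; 98; 0; 9; 50;
     101; 0; 10; 68; 104; 0; 11; 30; 97; 0; 13; 82; 95; 0; 16; 62; 64; 0; 17; 76; 96; 0;
     44; 60; 75; 0; 51; 52; 57; 0; 54; 72; 89; 0; 55; 80; 102; 0; 61; 81; 93; 0; 74; 78;
     99; 42; 45; 54; 94; 42; 52; 71; 100]);
   (28, 3, 3, 7, [:: 4; 4; 4; 1; 1; 1; 7; 2],
     [:: 0; 1; 47; 55; 0; 2; 5; 60; 0; 4; 57; 82; 0; 6; 15; 142; 0; 8; 39; 254; 0; 10;
     69; 84; 0; 11; 36; 113; 0; 12; 34; 257; 0; 29; 51; 115; 0; 30; 71; 87; 0; 32; 68;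
     281; 0; 33; 79; 112; 0; 37; 38; 48; 0; 40; 73; 168; 0; 41; 64; 224; 0; 43; 67; 196;
     0; 44; 76; 280; 0; 45; 62; 141; 0; 52; 72; 256; 0; 61; 65; 258; 0; 66; 74; 255; 0;
     75; 80; 85; 28; 30; 53; 84; 28; 32; 58; 252; 28; 37; 59; 75; 28; 40; 83; 254; 28;
     41; 57; 142; 28; 62; 68; 81; 28; 65; 67; 143; 56; 57; 74; 112]);
   (42, 2, 2, 7, [:: 21; 3; 3],
     [:: 0; 1; 16; 100; 0; 2; 66; 89; 0; 3; 61; 83; 0; 4; 57; 86; 0; 5; 30; 101; 0; 6;
     71; 104; 0; 8; 32; 52; 0; 9; 78; 85; 0; 11; 54; 127; 0; 13; 81; 94; 0; 19; 74; 88;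
     0; 20; 60; 168; 0; 45; 76; 126; 0; 46; 48; 170; 0; 47; 72; 93; 0; 50; 59; 91; 0; 51;
     67; 75; 0; 73; 79; 95; 42; 43; 80; 90; 42; 45; 57; 102; 42; 52; 65; 103]);
   (84, 1, 1, 7, [:: 12; 6; 6; 3; 3],
     [:: 0; 1; 17; 420; 0; 2; 34; 84; 0; 3; 44; 256; 0; 4; 19; 85; 0; 5; 25; 88; 0; 6;
     24; 36; 0; 8; 31; 336; 0; 9; 55; 169; 0; 10; 57; 89; 0; 11; 33; 170; 0; 13; 39;
     252]);
   (42, 2, 2, 7, [:: 21; 6; 6],
     [:: 0; 1; 82; 128; 0; 2; 20; 93; 0; 3; 74; 92; 0; 4; 73; 101; 0; 5; 48; 84; 0; 6;
     23; 87; 0; 8; 68; 168; 0; 9; 61; 126; 0; 10; 55; 67; 0; 11; 75; 88; 0; 12; 65; 86;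
     0; 13; 50; 131; 0; 15; 59; 90; 0; 16; 46; 171; 0; 47; 58; 103; 0; 51; 78; 104; 0;
     54; 76; 169; 0; 62; 66; 170; 0; 80; 83; 99; 42; 43; 48; 86; 42; 44; 60; 90; 42; 50;
     75; 104; 42; 52; 65; 126]);
   (42, 2, 2, 7, [:: 21; 6; 6; 3],
     [:: 0; 1; 48; 211; 0; 2; 15; 95; 0; 3; 83; 84; 0; 4; 68; 104; 0; 5; 22; 173; 0; 6;
     81; 97; 0; 8; 24; 90; 0; 9; 66; 98; 0; 10; 53; 127; 0; 11; 61; 131; 0; 12; 52; 85;
     0; 19; 73; 171; 0; 44; 76; 99; 0; 45; 51; 86; 0; 46; 58; 96; 0; 55; 59; 130; 0; 60;
     69; 88; 0; 62; 79; 128; 0; 65; 78; 212; 0; 67; 72; 172; 0; 71; 74; 92; 42; 43; 69;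
     94; 42; 44; 62; 89; 42; 50; 61; 169])].

Definition designs_12_9 : seq cyclic_design := [::
   (27, 4, 4, 9, [::],
     [:: 0; 1; 67; 69; 0; 2; 60; 77; 0; 3; 41; 43; 0; 4; 32; 53; 0; 5; 39; 47; 0; 6; 65;
     76; 0; 7; 96; 100; 0; 8; 55; 61; 0; 10; 85; 87; 0; 11; 44; 48; 0; 12; 82; 92; 0; 13;
     84; 91; 0; 29; 57; 86; 0; 30; 62; 95; 0; 31; 71; 106; 0; 35; 79; 101; 0; 46; 56; 88;
     0; 50; 64; 83; 0; 51; 73; 94; 0; 52; 78; 103; 27; 28; 62; 74; 27; 30; 85; 107; 27;
     32; 56; 57; 27; 34; 95; 101; 27; 37; 70; 75; 27; 38; 69; 77; 27; 39; 83; 91; 27; 40;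
     86; 89; 54; 57; 88; 104; 54; 58; 96; 97; 54; 61; 91; 105; 54; 67; 95; 107]);
   (54, 2, 2, 9, [:: 3],
     [:: 0; 1; 102; 106; 0; 2; 14; 73; 0; 3; 33; 65; 0; 4; 23; 64; 0; 5; 22; 88; 0; 6;
     47; 84; 0; 8; 76; 82; 0; 10; 39; 89; 0; 11; 96; 108; 0; 16; 56; 69; 0; 20; 97; 100;
     0; 26; 75; 87; 0; 55; 70; 98; 0; 57; 67; 110; 0; 58; 92; 93; 54; 56; 70; 77; 54; 59;
     76; 84]);
   (108, 1, 1, 9, [:: 3; 3],
     [:: 0; 1; 13; 43; 0; 2; 16; 23; 0; 3; 49; 53; 0; 5; 37; 61; 0; 6; 39; 70; 0; 8; 34;
     108; 0; 10; 29; 51; 0; 11; 28; 216; 0; 15; 35; 83]);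
   (54, 2, 2, 9, [:: 6; 3],
     [:: 0; 1; 6; 21; 0; 2; 89; 112; 0; 3; 13; 29; 0; 4; 23; 113; 0; 7; 80; 95; 0; 8; 65;
     70; 0; 11; 61; 86; 0; 12; 60; 68; 0; 14; 66; 98; 0; 17; 55; 164; 0; 22; 96; 100; 0;
     24; 91; 93; 0; 58; 101; 163; 0; 59; 97; 103; 0; 64; 76; 83; 0; 71; 85; 111; 0; 77;
     94; 107; 0; 79; 82; 105; 54; 55; 88; 109]);
   (36, 3, 3, 9, [:: 12],
     [:: 0; 1; 87; 106; 0; 2; 98; 102; 0; 3; 58; 78; 0; 4; 65; 118; 0; 5; 85; 97; 0; 6;
     23; 38; 0; 7; 46; 57; 0; 8; 42; 56; 0; 10; 21; 94; 0; 12; 52; 71; 0; 14; 103; 119;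
     0; 16; 95; 108; 0; 37; 41; 109; 0; 43; 53; 112; 0; 44; 74; 77; 0; 47; 60; 62; 0; 49;
     104; 111; 0; 64; 101; 115; 0; 66; 69; 76; 0; 67; 83; 110; 0; 82; 88; 93; 0; 91; 107;
     113; 36; 37; 43; 87; 36; 41; 75; 98; 36; 44; 85; 114; 36; 48; 76; 83; 36; 52; 84;
     94; 36; 74; 95; 96; 36; 89; 97; 109; 36; 101; 103; 112]);
   (54, 2, 2, 9, [:: 9; 6],
     [:: 0; 1; 35; 86; 0; 2; 68; 102; 0; 3; 58; 164; 0; 4; 11; 71; 0; 5; 29; 103; 0; 6;
     39; 89; 0; 8; 61; 73; 0; 10; 42; 110; 0; 13; 75; 111; 0; 14; 70; 165; 0; 16; 93;
     115; 0; 17; 96; 97; 0; 23; 82; 101; 0; 26; 64; 162; 0; 57; 106; 112; 0; 69; 91; 95;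
     0; 76; 84; 87; 0; 88; 94; 114; 54; 56; 93; 165; 54; 61; 75; 85; 54; 67; 83; 115]);
   (108, 1, 1, 9, [:: 18],
     [:: 0; 1; 16; 20; 0; 2; 46; 58; 0; 3; 86; 118; 0; 5; 37; 112; 0; 6; 47; 116; 0; 7;
     30; 40; 0; 8; 87; 117; 0; 11; 39; 53; 0; 13; 51; 121; 0; 17; 43; 77; 0; 24; 59;
     119]);
   (54, 2, 2, 9, [:: 18; 3],
     [:: 0; 1; 16; 30; 0; 2; 5; 91; 0; 4; 87; 88; 0; 6; 19; 119; 0; 7; 103; 164; 0; 8;
     28; 116; 0; 10; 69; 85; 0; 11; 32; 78; 0; 12; 80; 122; 0; 17; 77; 111; 0; 23; 71;
     125; 0; 55; 62; 117; 0; 56; 82; 93; 0; 57; 61; 101; 0; 58; 107; 121; 0; 64; 98; 106;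
     0; 65; 104; 114; 0; 66; 79; 109; 0; 70; 94; 123; 0; 73; 105; 162; 0; 74; 76; 97; 0;
     92; 95; 115; 54; 60; 89; 111]);
   (36, 3, 3, 9, [:: 12; 12],
     [:: 0; 1; 39; 116; 0; 2; 95; 151; 0; 3; 26; 79; 0; 4; 47; 78; 0; 5; 24; 40; 0; 6;
     28; 111; 0; 7; 48; 67; 0; 11; 82; 152; 0; 15; 106; 146; 0; 16; 85; 118; 0; 37; 62;
     145; 0; 42; 65; 109; 0; 44; 87; 147; 0; 46; 58; 86; 0; 49; 104; 112; 0; 50; 55; 92;
     0; 51; 53; 75; 0; 56; 57; 154; 0; 59; 66; 108; 0; 61; 77; 150; 0; 64; 68; 98; 0; 69;
     94; 144; 0; 70; 103; 148; 0; 73; 88; 102; 0; 80; 83; 110; 0; 84; 100; 113; 0; 96;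
     97; 101; 36; 39; 83; 107; 36; 42; 62; 112; 36; 44; 82; 92; 36; 50; 89; 154; 36; 51;
     101; 108; 36; 77; 85; 148; 36; 87; 98; 153; 36; 93; 95; 119; 72; 78; 95; 118]);
   (54, 2, 2, 9, [:: 27],
     [:: 0; 1; 26; 121; 0; 2; 58; 95; 0; 3; 68; 131; 0; 4; 79; 111; 0; 5; 16; 108; 0; 6;
     14; 94; 0; 7; 20; 89; 0; 10; 61; 112; 0; 12; 97; 109; 0; 15; 32; 74; 0; 19; 102;
     133; 0; 21; 70; 110; 0; 23; 87; 101; 0; 24; 77; 115; 0; 55; 98; 127; 0; 57; 92; 126;
     0; 60; 73; 117; 0; 62; 91; 132; 0; 66; 67; 113; 0; 71; 86; 123; 0; 76; 104; 125; 0;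
     84; 100; 106; 54; 56; 103; 109; 54; 57; 77; 87; 54; 58; 100; 108]);
   (54, 2, 2, 9, [:: 18; 9; 3],
     [:: 0; 1; 12; 125; 0; 2; 94; 117; 0; 3; 31; 98; 0; 4; 101; 122; 0; 5; 83; 163; 0; 6;
     20; 82; 0; 7; 22; 109; 0; 8; 37; 111; 0; 10; 96; 217; 0; 13; 65; 166; 0; 16; 71;
     114; 0; 19; 88; 169; 0; 21; 89; 91; 0; 24; 57; 77; 0; 56; 59; 170; 0; 58; 74; 84; 0;
     60; 66; 73; 0; 61; 80; 165; 0; 64; 103; 164; 0; 75; 104; 218; 0; 79; 93; 108; 0; 85;
     102; 112; 0; 100; 105; 119; 54; 55; 85; 121; 54; 58; 100; 116; 54; 65; 87; 125]);
   (54, 2, 2, 9, [:: 27; 6],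
     [:: 0; 1; 35; 122; 0; 2; 77; 166; 0; 3; 55; 111; 0; 4; 46; 93; 0; 5; 62; 123; 0; 6;
     32; 134; 0; 7; 104; 112; 0; 10; 69; 119; 0; 11; 87; 127; 0; 13; 83; 110; 0; 14; 30;
     88; 0; 15; 66; 79; 0; 17; 65; 120; 0; 21; 67; 125; 0; 23; 96; 162; 0; 25; 85; 115;
     0; 56; 78; 126; 0; 61; 107; 165; 0; 68; 94; 133; 0; 71; 86; 92; 0; 80; 82; 167; 0;
     84; 91; 103; 0; 95; 98; 113; 54; 55; 65; 133; 54; 58; 92; 118; 54; 59; 83; 130; 54;
     68; 91; 127]);
   (36, 3, 3, 9, [:: 18; 18],
     [:: 0; 1; 6; 154; 0; 2; 96; 120; 0; 3; 23; 144; 0; 4; 64; 150; 0; 7; 40; 108; 0; 8;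
     79; 123; 0; 10; 93; 152; 0; 11; 87; 110; 0; 12; 100; 121; 0; 14; 103; 151; 0; 15;
     38; 77; 0; 17; 43; 78; 0; 37; 65; 116; 0; 39; 85; 106; 0; 41; 55; 156; 0; 42; 95;
     112; 0; 44; 56; 111; 0; 46; 67; 105; 0; 47; 66; 73; 0; 48; 50; 114; 0; 49; 91; 125;
     0; 51; 61; 149; 0; 52; 74; 145; 0; 53; 102; 124; 0; 57; 68; 113; 0; 58; 92; 147; 0;
     70; 86; 161; 0; 71; 82; 101; 0; 75; 104; 122; 0; 80; 84; 158; 36; 37; 42; 154; 36;
     39; 59; 144; 36; 40; 100; 150; 36; 43; 76; 108; 36; 73; 101; 116; 36; 77; 91; 156;
     36; 80; 92; 111; 36; 84; 86; 114; 36; 87; 97; 149; 36; 93; 104; 113; 72; 73; 78;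
     154; 72; 75; 95; 144]);
   (54, 2, 2, 9, [:: 27; 9; 3],
     [:: 0; 1; 8; 127; 0; 2; 60; 216; 0; 3; 19; 131; 0; 4; 57; 92; 0; 5; 85; 111; 0; 6;
     104; 109; 0; 10; 40; 118; 0; 11; 26; 113; 0; 12; 89; 170; 0; 13; 68; 78; 0; 17; 66;
     110; 0; 20; 87; 165; 0; 21; 83; 116; 0; 22; 59; 61; 0; 23; 102; 169; 0; 25; 101;
     121; 0; 56; 96; 134; 0; 64; 105; 166; 0; 69; 97; 124; 0; 70; 94; 115; 0; 71; 74;
     117; 0; 73; 106; 162; 0; 75; 95; 125; 0; 82; 86; 168; 0; 84; 100; 218; 54; 55; 60;
     116; 54; 61; 93; 130; 54; 62; 79; 120; 54; 65; 77; 117]);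
   (36, 3, 3, 9, [:: 36; 6],
     [:: 0; 1; 58; 110; 0; 2; 75; 125; 0; 3; 7; 134; 0; 5; 79; 137; 0; 6; 19; 97; 0; 8;
     46; 116; 0; 10; 49; 145; 0; 11; 43; 140; 0; 12; 62; 111; 0; 14; 80; 128; 0; 15; 100;
     141; 0; 16; 40; 119; 0; 37; 93; 149; 0; 41; 89; 117; 0; 42; 64; 120; 0; 44; 59; 113;
     0; 47; 53; 66; 0; 48; 103; 112; 0; 51; 88; 146; 0; 52; 83; 118; 0; 55; 96; 136; 0;
     56; 107; 148; 0; 61; 77; 143; 0; 65; 70; 130; 0; 67; 92; 138; 0; 69; 71; 122; 0; 76;
     101; 133; 0; 82; 94; 121; 0; 84; 104; 115; 0; 86; 87; 124; 0; 95; 105; 144; 0; 98;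
     106; 142; 36; 37; 94; 110; 36; 39; 43; 134; 36; 44; 82; 116; 36; 46; 85; 145; 36;
     47; 79; 140; 36; 48; 98; 111; 36; 52; 76; 119; 36; 78; 100; 120; 36; 80; 95; 113;
     36; 83; 89; 102; 36; 101; 106; 130; 36; 105; 107; 122; 72; 75; 79; 134]);
   (54, 2, 2, 9, [:: 27; 18],
     [:: 0; 1; 74; 177; 0; 2; 62; 121; 0; 3; 59; 120; 0; 4; 26; 168; 0; 5; 76; 116; 0; 6;
     37; 163; 0; 7; 42; 179; 0; 8; 66; 100; 0; 10; 61; 132; 0; 11; 95; 167; 0; 13; 96;
     115; 0; 14; 39; 110; 0; 16; 86; 128; 0; 20; 88; 126; 0; 21; 103; 130; 0; 24; 55;
     131; 0; 57; 97; 127; 0; 64; 89; 170; 0; 65; 104; 113; 0; 67; 69; 165; 0; 75; 106;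
     114; 0; 77; 87; 169; 0; 78; 102; 171; 0; 79; 107; 108; 0; 80; 101; 166; 0; 91; 98;
     124; 0; 93; 94; 118; 54; 57; 103; 169; 54; 58; 96; 167; 54; 60; 97; 128; 54; 67; 86;
     131]);
   (108, 1, 1, 9, [:: 6; 27; 12; 3],
     [:: 0; 1; 80; 332; 0; 2; 95; 235; 0; 3; 101; 111; 0; 4; 65; 326; 0; 5; 35; 219; 0;
     6; 38; 234; 0; 8; 68; 232; 0; 11; 42; 231; 0; 12; 94; 225; 0; 16; 69; 113; 0; 17;
     58; 432; 0; 19; 75; 330; 0; 20; 57; 229; 0; 21; 44; 325; 0; 22; 46; 222; 0; 25; 59;
     242])].

Definition designs_2_21 : seq cyclic_design := [::
   (14, 3, 1, 7, [:: 2],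
     [:: 0; 1; 4; 39; 0; 2; 22; 23; 0; 5; 31; 32; 0; 6; 19; 36; 0; 14; 17; 26; 0; 15; 29;
     43; 0; 16; 24; 28; 0; 18; 34; 37; 0; 25; 33; 42; 14; 18; 29; 38; 14; 35; 37; 41]);
   (7, 6, 2, 7, [:: 1; 1; 1; 1; 1],
     [:: 0; 1; 15; 27; 0; 2; 28; 36; 0; 3; 19; 40; 0; 8; 25; 56; 0; 9; 38; 42; 0; 10; 31;
     70; 0; 11; 17; 29; 0; 12; 13; 24; 0; 18; 20; 22; 0; 21; 32; 34; 0; 23; 39; 49; 0;
     30; 35; 63; 7; 9; 23; 37; 7; 10; 18; 29; 7; 14; 17; 39; 7; 16; 30; 49; 7; 19; 27;
     63; 7; 22; 31; 34; 7; 38; 40; 41; 14; 15; 30; 41; 14; 24; 34; 42; 14; 27; 38; 70;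
     14; 31; 37; 56; 21; 22; 26; 41; 21; 28; 29; 38]);
   (14, 3, 1, 7, [:: 7; 1],
     [:: 0; 1; 4; 46; 0; 2; 30; 38; 0; 5; 26; 31; 0; 6; 23; 24; 0; 14; 32; 35; 0; 15; 20;
     47; 0; 16; 29; 56; 0; 19; 22; 43; 0; 25; 27; 37; 0; 33; 34; 44; 0; 39; 41; 48; 14;
     18; 34; 47; 14; 20; 28; 37; 14; 29; 39; 44]);
   (7, 6, 2, 7, [:: 1; 1; 7; 1; 1],
     [:: 0; 1; 23; 38; 0; 2; 32; 58; 0; 3; 17; 19; 0; 8; 12; 29; 0; 9; 20; 59; 0; 10; 24;
     70; 0; 11; 39; 42; 0; 13; 31; 62; 0; 15; 18; 36; 0; 21; 41; 63; 0; 25; 34; 61; 0;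
     26; 27; 57; 0; 28; 40; 60; 0; 33; 35; 49; 7; 8; 20; 24; 7; 9; 39; 60; 7; 14; 38; 62;
     7; 15; 34; 63; 7; 16; 36; 61; 7; 17; 22; 49; 7; 25; 27; 33; 7; 26; 29; 59; 7; 30;
     40; 41; 14; 15; 23; 58; 14; 24; 31; 42; 14; 27; 32; 61; 14; 28; 36; 70; 14; 29; 30;
     34; 14; 37; 40; 56; 21; 24; 35; 40; 21; 32; 38; 60]);
   (14, 3, 1, 7, [:: 2; 7; 2; 1; 2],
     [:: 0; 1; 32; 71; 0; 2; 23; 39; 0; 3; 9; 59; 0; 4; 17; 58; 0; 14; 33; 42; 0; 15; 30;
     99; 0; 16; 29; 43; 0; 18; 26; 62; 0; 19; 20; 22; 0; 24; 35; 84; 0; 25; 34; 98; 0;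
     28; 36; 41; 0; 38; 40; 60; 14; 18; 36; 60; 14; 19; 40; 70; 14; 28; 31; 61; 14; 34;
     38; 59]);
   (7, 6, 2, 7, [:: 7; 7; 1; 1; 1],
     [:: 0; 1; 25; 46; 0; 2; 15; 39; 0; 3; 17; 47; 0; 8; 41; 56; 0; 9; 11; 53; 0; 10; 34;
     63; 0; 12; 18; 52; 0; 13; 23; 54; 0; 16; 31; 42; 0; 19; 30; 50; 0; 21; 29; 70; 0;
     22; 40; 55; 0; 26; 28; 48; 0; 27; 35; 49; 0; 32; 33; 51; 0; 36; 38; 43; 7; 8; 36;
     53; 7; 10; 19; 43; 7; 14; 26; 27; 7; 15; 34; 44; 7; 17; 37; 70; 7; 18; 28; 50; 7;
     21; 23; 46; 7; 22; 39; 48; 7; 25; 41; 42; 7; 29; 33; 45; 7; 30; 32; 38; 14; 15; 17;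
     42; 14; 22; 35; 54; 14; 23; 30; 51; 14; 24; 28; 56; 14; 25; 37; 63; 14; 34; 39; 50;
     14; 36; 40; 49; 21; 24; 34; 51; 21; 33; 35; 48; 28; 38; 39; 42]);
   (14, 3, 1, 7, [:: 14; 1; 2; 2; 1],
     [:: 0; 1; 22; 84; 0; 2; 17; 55; 0; 3; 9; 54; 0; 4; 38; 46; 0; 14; 16; 47; 0; 18; 26;
     48; 0; 19; 41; 70; 0; 20; 32; 43; 0; 23; 30; 44; 0; 24; 37; 98; 0; 25; 40; 56; 0;
     27; 33; 71; 0; 28; 29; 49; 0; 31; 35; 50; 0; 36; 39; 52; 14; 15; 25; 54; 14; 19; 28;
     46; 14; 30; 32; 42; 14; 31; 39; 48; 14; 33; 38; 85])].

Definition designs_2_27 : seq cyclic_design := [::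
   (18, 3, 1, 9, [:: 1; 1],
     [:: 0; 1; 5; 52; 0; 2; 25; 48; 0; 3; 11; 31; 0; 6; 33; 50; 0; 18; 36; 72; 0; 19; 21;
     26; 0; 22; 34; 49; 0; 24; 32; 43; 0; 29; 39; 45; 0; 30; 42; 54; 0; 35; 37; 41; 0;
     38; 40; 53; 18; 19; 22; 44; 18; 39; 49; 50]);
   (9, 6, 2, 9, [:: 1; 1; 1; 1; 1],
     [:: 0; 1; 40; 42; 0; 2; 48; 53; 0; 3; 32; 34; 0; 4; 15; 16; 0; 10; 17; 27; 0; 13;
     28; 38; 0; 14; 35; 43; 0; 18; 45; 90; 0; 19; 33; 49; 0; 20; 25; 36; 0; 21; 52; 72;
     0; 22; 44; 54; 0; 23; 37; 63; 0; 24; 47; 81; 0; 26; 30; 50; 9; 12; 46; 47; 9; 13;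
     24; 25; 9; 18; 39; 42; 9; 19; 26; 45; 9; 22; 41; 51; 9; 23; 40; 48; 9; 27; 36; 90;
     9; 29; 50; 54; 9; 31; 44; 72; 9; 32; 37; 81; 9; 34; 49; 63; 18; 21; 28; 29; 18; 30;
     33; 36; 27; 31; 50; 53; 27; 38; 43; 45; 36; 37; 49; 51]);
   (18, 3, 1, 9, [:: 1; 1; 1; 3; 1; 1],
     [:: 0; 1; 7; 22; 0; 2; 34; 108; 0; 3; 8; 52; 0; 4; 29; 41; 0; 18; 36; 126; 0; 19;
     45; 54; 0; 20; 23; 28; 0; 24; 48; 144; 0; 26; 53; 90; 0; 27; 46; 72; 0; 30; 43; 47;
     0; 31; 35; 42; 0; 38; 40; 110; 0; 39; 50; 51; 18; 19; 25; 40; 18; 20; 52; 108; 18;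
     38; 41; 46]);
   (9, 6, 2, 9, [:: 9; 1; 1],
     [:: 0; 1; 32; 59; 0; 2; 10; 46; 0; 3; 33; 51; 0; 4; 24; 25; 0; 11; 16; 36; 0; 12;
     35; 55; 0; 13; 19; 63; 0; 14; 26; 72; 0; 15; 28; 62; 0; 18; 29; 34; 0; 22; 50; 57;
     0; 23; 49; 60; 0; 27; 37; 44; 0; 38; 43; 54; 0; 39; 47; 61; 0; 40; 41; 45; 0; 42;
     52; 56; 9; 10; 23; 50; 9; 11; 19; 55; 9; 12; 33; 42; 9; 18; 28; 35; 9; 20; 37; 58;
     9; 25; 44; 59; 9; 27; 46; 53; 9; 29; 41; 60; 9; 34; 40; 57; 9; 36; 47; 52; 9; 48;
     51; 54; 18; 20; 40; 43; 18; 21; 42; 60; 18; 22; 51; 52; 18; 30; 50; 58; 18; 31; 32;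
     36; 18; 33; 49; 59; 27; 30; 51; 60; 27; 38; 50; 63; 27; 43; 49; 72]);
   (18, 3, 1, 9, [:: 9; 2; 1; 1; 1],
     [:: 0; 1; 13; 18; 0; 2; 21; 56; 0; 3; 11; 31; 0; 4; 38; 62; 0; 22; 32; 60; 0; 24;
     48; 73; 0; 25; 45; 55; 0; 26; 53; 57; 0; 27; 40; 61; 0; 29; 44; 90; 0; 30; 42; 72;
     0; 33; 37; 126; 0; 34; 39; 108; 0; 36; 43; 49; 0; 41; 51; 59; 0; 46; 47; 50; 18; 19;
     25; 36; 18; 20; 33; 52; 18; 22; 43; 54; 18; 44; 46; 60]);
   (9, 6, 2, 9, [:: 3; 3; 3; 1; 1; 3; 1; 1; 1],
     [:: 0; 1; 41; 56; 0; 2; 37; 100; 0; 3; 28; 29; 0; 4; 10; 12; 0; 11; 51; 65; 0; 13;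
     38; 117; 0; 14; 43; 126; 0; 16; 48; 73; 0; 18; 45; 108; 0; 19; 33; 63; 0; 20; 25;
     27; 0; 21; 42; 64; 0; 22; 32; 81; 0; 23; 31; 90; 0; 24; 39; 74; 0; 26; 30; 72; 0;
     36; 49; 50; 0; 46; 53; 99; 0; 47; 52; 54; 9; 10; 23; 101; 9; 12; 24; 42; 9; 13; 20;
     56; 9; 18; 48; 51; 9; 19; 26; 54; 9; 27; 36; 108; 9; 28; 41; 65; 9; 29; 34; 99; 9;
     30; 33; 45; 9; 31; 53; 74; 9; 32; 46; 64; 9; 35; 40; 73; 9; 37; 47; 81; 9; 44; 52;
     90; 18; 19; 50; 101; 18; 21; 37; 38; 18; 30; 46; 117; 18; 33; 53; 126; 18; 40; 47;
     63; 18; 41; 52; 72; 27; 29; 46; 55; 27; 37; 44; 99; 27; 38; 43; 54; 27; 39; 42; 45]);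
   (18, 3, 1, 9, [:: 6; 6; 6; 2],
     [:: 0; 1; 38; 55; 0; 2; 6; 41; 0; 3; 49; 94; 0; 5; 45; 58; 0; 7; 36; 75; 0; 8; 34;
     92; 0; 18; 19; 93; 0; 20; 27; 73; 0; 21; 44; 56; 0; 22; 43; 72; 0; 23; 28; 77; 0;
     24; 48; 108; 0; 25; 31; 33; 0; 29; 32; 57; 0; 30; 42; 109; 0; 35; 51; 95; 0; 50; 52;
     76; 18; 22; 50; 54; 18; 36; 49; 57; 18; 37; 43; 51; 18; 38; 53; 75; 18; 40; 47; 95;
     18; 44; 45; 91]);
   (9, 6, 2, 9, [:: 9; 9; 1; 1; 1; 1; 1],
     [:: 0; 1; 19; 65; 0; 2; 10; 57; 0; 3; 31; 63; 0; 4; 52; 70; 0; 11; 46; 71; 0; 12;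
     13; 40; 0; 14; 22; 59; 0; 15; 34; 68; 0; 16; 37; 60; 0; 20; 33; 62; 0; 21; 42; 99;
     0; 23; 53; 72; 0; 24; 39; 108; 0; 25; 45; 56; 0; 26; 27; 29; 0; 30; 43; 90; 0; 32;
     47; 81; 0; 35; 44; 61; 0; 36; 41; 67; 0; 38; 49; 58; 0; 50; 51; 54; 9; 12; 46; 61;
     9; 13; 35; 70; 9; 18; 40; 59; 9; 27; 45; 99; 9; 29; 32; 60; 9; 30; 51; 108; 9; 47;
     49; 68; 10; 36; 51; 65; 11; 18; 44; 81; 11; 35; 36; 72; 13; 18; 19; 67; 14; 18; 53;
     90; 15; 17; 18; 54; 16; 18; 32; 65; 16; 36; 39; 63; 18; 20; 36; 70; 18; 21; 46; 63;
     18; 22; 29; 61; 18; 33; 49; 71; 18; 35; 37; 62; 18; 38; 45; 50; 18; 41; 51; 56; 27;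
     28; 47; 67; 27; 50; 53; 60; 29; 33; 36; 54; 30; 36; 38; 66; 31; 36; 53; 68; 36; 37;
     50; 58]);
   (9, 6, 2, 9, [:: 9; 9; 1; 1; 1; 1; 1; 1; 1; 1],
     [:: 0; 1; 27; 61; 0; 2; 18; 70; 0; 3; 41; 59; 0; 4; 29; 62; 0; 10; 17; 57; 0; 11;
     53; 55; 0; 12; 23; 108; 0; 13; 47; 90; 0; 14; 51; 117; 0; 15; 32; 63; 0; 16; 26; 81;
     0; 19; 22; 54; 0; 20; 48; 66; 0; 21; 42; 126; 0; 24; 39; 135; 0; 28; 30; 65; 0; 31;
     37; 67; 0; 33; 49; 71; 0; 36; 44; 64; 0; 40; 50; 72; 0; 43; 46; 99; 0; 45; 52; 69;
     9; 12; 47; 57; 9; 13; 18; 69; 9; 27; 45; 126; 9; 31; 34; 61; 9; 33; 48; 135; 9; 36;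
     40; 55; 10; 18; 51; 65; 10; 36; 38; 61; 11; 18; 32; 61; 11; 36; 51; 63; 12; 13; 36;
     71; 12; 18; 41; 66; 14; 18; 28; 72; 15; 18; 35; 99; 15; 34; 36; 68; 18; 19; 50; 56;
     18; 20; 47; 60; 18; 22; 40; 71; 18; 29; 34; 57; 18; 30; 44; 117; 18; 31; 38; 90; 18;
     33; 53; 63; 18; 37; 43; 54; 18; 48; 52; 68; 27; 28; 36; 69; 27; 46; 49; 58; 32; 36;
     53; 58; 33; 36; 47; 108; 35; 36; 52; 81; 36; 49; 50; 57])].

(** With v = 1 no symmetry is imposed: all 100 blocks of a TD(4, 10) are listed. *)
Definition designs_10_3 : seq cyclic_design := [::
   (1, 30, 10, 1, nseq 10 1,
     [:: 0; 10; 26; 39; 0; 11; 23; 37; 0; 12; 25; 38; 0; 13; 27; 36; 0; 14; 29; 35; 0;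
     15; 28; 32; 0; 16; 20; 34; 0; 17; 24; 30; 0; 18; 22; 31; 0; 19; 21; 33; 1; 10; 21;
     35; 1; 11; 20; 39; 1; 12; 24; 37; 1; 13; 26; 38; 1; 14; 27; 30; 1; 15; 29; 36; 1;
     16; 28; 33; 1; 17; 25; 31; 1; 18; 23; 32; 1; 19; 22; 34; 2; 10; 28; 34; 2; 11; 22;
     36; 2; 12; 21; 39; 2; 13; 25; 37; 2; 14; 20; 38; 2; 15; 27; 31; 2; 16; 29; 30; 2;
     17; 26; 32; 2; 18; 24; 33; 2; 19; 23; 35; 3; 10; 29; 31; 3; 11; 28; 35; 3; 12; 23;
     30; 3; 13; 22; 39; 3; 14; 26; 37; 3; 15; 21; 38; 3; 16; 27; 32; 3; 17; 20; 33; 3;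
     18; 25; 34; 3; 19; 24; 36; 4; 10; 27; 33; 4; 11; 29; 32; 4; 12; 28; 36; 4; 13; 24;
     31; 4; 14; 23; 39; 4; 15; 20; 37; 4; 16; 22; 38; 4; 17; 21; 34; 4; 18; 26; 35; 4;
     19; 25; 30; 5; 10; 23; 38; 5; 11; 27; 34; 5; 12; 29; 33; 5; 13; 28; 30; 5; 14; 25;
     32; 5; 15; 24; 39; 5; 16; 21; 37; 5; 17; 22; 35; 5; 18; 20; 36; 5; 19; 26; 31; 6;
     10; 22; 37; 6; 11; 24; 38; 6; 12; 27; 35; 6; 13; 29; 34; 6; 14; 28; 31; 6; 15; 26;
     33; 6; 16; 25; 39; 6; 17; 23; 36; 6; 18; 21; 30; 6; 19; 20; 32; 7; 10; 24; 32; 7;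
     11; 25; 33; 7; 12; 26; 34; 7; 13; 20; 35; 7; 14; 21; 36; 7; 15; 22; 30; 7; 16; 23;
     31; 7; 17; 27; 37; 7; 18; 28; 39; 7; 19; 29; 38; 8; 10; 25; 36; 8; 11; 26; 30; 8;
     12; 20; 31; 8; 13; 21; 32; 8; 14; 22; 33; 8; 15; 23; 34; 8; 16; 24; 35; 8; 17; 28;
     38; 8; 18; 29; 37; 8; 19; 27; 39; 9; 10; 20; 30; 9; 11; 21; 31; 9; 12; 22; 32; 9;
     13; 23; 33; 9; 14; 24; 34; 9; 15; 25; 35; 9; 16; 26; 36; 9; 17; 29; 39; 9; 18; 27;
     38; 9; 19; 28; 37])].

(** Under Z_7 the 28 base blocks yield the 14^2 blocks of a TD(4, 14). *)
Definition designs_14_3 : seq cyclic_design := [::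
   (7, 6, 2, 1, [:: 7; 7],
     [:: 0; 14; 34; 42; 0; 15; 38; 45; 0; 16; 30; 52; 0; 17; 32; 43; 0; 18; 36; 55; 0;
     19; 39; 48; 0; 20; 37; 54; 0; 21; 33; 47; 0; 22; 29; 53; 0; 23; 35; 46; 0; 24; 28;
     51; 0; 25; 31; 50; 0; 26; 41; 44; 0; 27; 40; 49; 7; 14; 36; 54; 7; 15; 32; 50; 7;
     16; 35; 55; 7; 17; 33; 42; 7; 18; 29; 49; 7; 19; 31; 43; 7; 20; 41; 47; 7; 21; 30;
     51; 7; 22; 38; 46; 7; 23; 40; 45; 7; 24; 34; 44; 7; 25; 39; 53; 7; 26; 37; 52; 7;
     27; 28; 48])].
Lemma check_6_5 : table_check 6 5 0 designs_6_5. Proof. by vm_compute. Qed.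
Lemma check_6_7 : table_check 6 7 0 designs_6_7. Proof. by vm_compute. Qed.
Lemma check_6_9 : table_check 6 9 0 designs_6_9. Proof. by vm_compute. Qed.
Lemma check_12_5 : table_check 12 5 0 designs_12_5. Proof. by vm_compute. Qed.
Lemma check_12_7 : table_check 12 7 0 designs_12_7. Proof. by vm_compute. Qed.
Lemma check_12_9 : table_check 12 9 0 designs_12_9. Proof. by vm_compute. Qed.
Lemma check_2_21 : table_check 2 21 2 designs_2_21. Proof. by vm_compute. Qed.
Lemma check_2_27 : table_check 2 27 2 designs_2_27. Proof. by vm_compute. Qed.
Lemma check_10_3 : table_check 10 3 10 designs_10_3. Proof. by vm_compute. Qed.
Lemma check_14_3 : table_check 14 3 14 designs_14_3. Proof. by vm_compute. Qed.

(** * The theorem *)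

Lemma gdd_residue_table (g u c K : nat) (Ds : seq cyclic_design) :
  table_check g u c Ds -> size Ds = K.+1 ->
  forall n, n <= K -> gdd g u (c + 3 * n).
Proof. by move=> check size_D n le_n; apply: gdd_table check _; rewrite size_D. Qed.

Lemma gdd_6_multiple (u h : nat) : u \in [:: 5; 7; 9] -> 0 < h -> ~~ (3 %| h) ->
  forall n, n <= h * u.-1 -> gdd (6 * h) u (3 * n).
Proof.
move=> u_in h0 h3; apply: gdd_closure => //; move: u_in; rewrite !inE => /or3P[] /eqP -> //.
- exact: gdd_residue_table check_6_5 _.
- exact: gdd_residue_table check_6_7 _.
- exact: gdd_residue_table check_6_9 _.
- exact: gdd_residue_table check_12_5 _.
- exact: gdd_residue_table check_12_7 _.
- exact: gdd_residue_table check_12_9 _.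
Qed.

(** With h = g/2, the limit (m-g)/3 <= h(u-1) of [gdd_6_multiple] is the same as 2m <= g(3u-1), so
    nothing is lost. *)
Lemma gdd_large_group (g u m : nat) : u \in [:: 5; 7; 9] -> ~~ odd g -> ~~ (3 %| g) ->
  2 < g -> m = g %[mod 3] -> g <= m -> 2 * m <= g * (3 * u).-1 -> gdd g (3 * u) m.
Proof.
move=> u_in even_g g3 g2 m_g le_gm le_m.
have g10 : gdd 10 3 10 by apply: (gdd_table (i := 0) check_10_3).
have g14 : gdd 14 3 14 by apply: (gdd_table (i := 0) check_14_3).
rewrite -(subnK le_gm); apply: gdd_fill_groups; last exact: gdd_square_even.
have -> : g * 3 = 6 * g./2 by lia.
have -> : m - g = 3 * ((m - g) %/ 3) by lia.
apply: gdd_6_multiple => //; first 1 [lia | lia].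
by move: u_in le_m; rewrite !inE => /or3P[] /eqP -> /=; lia.
Qed.

(** The group to be replaced has 6g + d < 7g points, within the bound g(u-1)/2 as soon as u >= 15,
    and 6g + d is still congruent to g modulo 3. *)
Lemma gdd_small_group (g u d : nat) : 0 < d -> d < g -> d = g %[mod 3] ->
  (forall d : nat, 0 < d -> d < g -> d = g %[mod 3] -> exists_kGDD 4 (type_gum g 6 d)) ->
  (forall m, m = g %[mod 3] -> g <= m -> 2 * m <= g * u.-1 -> gdd g u m) ->
  14 < u -> gdd g (u + 6) d.
Proof.
move=> d0 lt_dg d_g Hyp Hu u14; apply: gdd_fill_hole.
  apply: Hu; [lia | lia | nia].
exact/gdd_of_exists_kGDD/Hyp.
Qed.

Theorem theorem3p6 (g : nat) :
  0 < g ->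
  (g %% 6 = 2 \/ g %% 6 = 4) ->
  (forall d : nat, 0 < d -> d < g -> d = g %[mod 3] ->
     exists_kGDD 4 (type_gum g 6 d)) ->
  (forall m1 : nat, 0 < m1 -> m1 = g %[mod 3] -> m1 <= 10 * g ->
     exists_kGDD 4 (type_gum g 21 m1)) /\
  (forall m2 : nat, 0 < m2 -> m2 = g %[mod 3] -> m2 <= 13 * g ->
     exists_kGDD 4 (type_gum g 27 m2)).
Proof.
move=> g0 g6 Hyp.
suff [H21 H27] : (forall m, 0 < m -> m = g %[mod 3] -> m <= 10 * g -> gdd g 21 m) /\
                 (forall m, 0 < m -> m = g %[mod 3] -> m <= 13 * g -> gdd g 27 m).
  by split=> m m0 m_g le_m; apply: exists_kGDD_of_gdd => //; [apply: H21 | apply: H27].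
have [g2|g2] := eqVneq g 2.
  (* A positive m congruent to 2 modulo 3 is at least 2, so the truncated m - 2 is exact. *)
  rewrite g2; split=> m m0 m_g le_m; have -> : m = 2 + 3 * ((m - 2) %/ 3) by lia.
  - by apply: gdd_table check_2_21 _; rewrite (_ : size _ = 7) //; lia.
  - by apply: gdd_table check_2_27 _; rewrite (_ : size _ = 9) //; lia.
have Hlarge u : u \in [:: 5; 7; 9] -> forall m, m = g %[mod 3] -> g <= m ->
    2 * m <= g * (3 * u).-1 -> gdd g (3 * u) m.
  by move=> u_in m m_g le_gm le_m; apply: gdd_large_group => //; lia.
have H21 m : 0 < m -> m = g %[mod 3] -> m <= 10 * g -> gdd g 21 m.
  move=> m0 m_g le_m.
  have [le_gm|lt_mg] := leqP g m; first by apply: (Hlarge 7) => //=; lia.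
  exact: (@gdd_small_group g 15) (Hlarge 5 isT) isT.
split=> // m m0 m_g le_m.
have [le_gm|lt_mg] := leqP g m; first by apply: (Hlarge 9) => //=; lia.
exact: (@gdd_small_group g 21) (Hlarge 7 isT) isT.
Qed.
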